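(* Let $\Gamma$ be an infinite finitely generated nilpotent group. Then $\mathrm{F}_\Gamma(n)\approx(\log n)^{h(\Gamma)}$ if and only if $h(Z(\Gamma/T(\Gamma)))=1$.
   Context: For non-decreasing non-negative functions $f,g$ on $\mathbb{N}=\{1,2,\dots\}$, write $f\preceq g$ if there is $C\in\mathbb{N}$ with $f(n)\le C\,g(Cn)$ for all $n$, and $f\approx g$ if $f\preceq g$ and $g\preceq f$. For a finitely generated group $\Gamma$ with finite generating subset $S$ and word length $\|\cdot\|_S$, put $\mathrm{D}_\Gamma(\gamma)=\min\{|Q| : \varphi:\Gamma\to Q \text{ a surjective homomorphism to a finite group},\ \varphi(\gamma)\ne 1\}$ for $\gamma\neq1$, and $\mathrm{F}_{\Gamma,S}(n)=\max\{\mathrm{D}_\Gamma(\gamma) : \gamma\ne 1,\ \|\gamma\|_S\le n\}$. Up to $\approx$ this is independent of $S$, and one writes $\mathrm{F}_\Gamma$. $T(\Gamma)$ is the (finite, normal) subgroup of finite order elements of $\Gamma$; $h$ denotes Hirsch length; $Z(\cdot)$ denotes the center. *)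

(* Defs.v *)
From HB Require Import structures.
From mathcomp Require Import fingroup all_boot all_order all_algebra.
From mathcomp Require Import all_classical all_reals all_analysis.

Set Implicit Arguments.
Unset Strict Implicit.
Unset Printing Implicit Defensive.

Import Order.TTheory GRing.Theory Num.Theory.

Local Open Scope classical_set_scope.
Local Open Scope group_scope.

(* Extrema of sets of natural numbers, with value 0 when there is none. *)
Definition nat_min (A : set nat) : nat := xget 0%N (A `&` lbound A).
Definition nat_max (A : set nat) : nat := xget 0%N (A `&` ubound A).

Section Subgroups.
Variable G : groupType.
Implicit Types (A B H K S : set G) (x y g : G).

Definition subgroup H : Prop := H 1 /\ (forall x y, H x -> H y -> H (x / y)).

Definition generated_subgroup S : set G := smallest subgroup S.

Definition normal_in H K : Prop :=
  [/\ subgroup H, subgroup K, H `<=` K & forall x y, H x -> K y -> H (x ^ y)].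

Definition normal_closure S : set G := smallest (normal_in ^~ setT) S.

Definition group_center : set G := [set x | forall y, x * y = y * x].

Definition torsion : set G := [set x | exists2 n, (0 < n)%N & x ^+ n = 1].

Fixpoint lower_central_series (n : nat) : set G :=
  if n is m.+1 then
    generated_subgroup
      [set z | exists x y, lower_central_series m x /\ z = [~ x, y]]
  else setT.

Definition nilpotent_group : Prop :=
  exists n, lower_central_series n = [set 1].

Definition lcoset_set x H : set G := [set x * h | h in H].

Definition lcosets_in K H : set (set G) := [set lcoset_set x H | x in K].

(* [K / H] is a cyclic group, for [H] normal in [K]. *)
Definition cyclic_quotient K H : Prop :=
  exists2 x, K x & forall y, K y -> exists n : nat,
    lcoset_set y H = lcoset_set (x ^+ n) H \/
    lcoset_set y H = lcoset_set (x ^- n) H.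

(* [L 0, ..., L n] is a subnormal series from 1 to [K] with cyclic factors. *)
Definition polycyclic_series K (n : nat) (L : nat -> set G) : Prop :=
  [/\ L 0%N = [set 1], L n = K &
      forall i, (i < n)%N ->
        normal_in (L i) (L i.+1) /\ cyclic_quotient (L i.+1) (L i)].

(* [k] is the number of infinite factors of some polycyclic series of [K];
   such a [k] is unique when it exists. *)
Definition has_hirsch_length K (k : nat) : Prop :=
  exists n L, polycyclic_series K n L /\
    k = #|[pred i : 'I_n | `[< infinite_set (lcosets_in (L i.+1) (L i)) >]]|.

(* Equal to 0 when [K] is not polycyclic. *)
Definition hirsch_length K : nat := xget 0%N (has_hirsch_length K).

Lemma normal_in_normal_closure S : normal_in (normal_closure S) setT.
Proof.
have sT : subgroup [set: G] by [].
split => //.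
- split=> [A [[[]]] //|x y Hx Hy A [nA sA]].
  by have [[_ h] _ _ _] := nA; apply: h; [apply: Hx | apply: Hy].
- move=> x y Hx _ A [nA sA]; have [_ _ _ h] := nA.
  by apply: h => //; apply: Hx.
Qed.

Lemma normal_closure_id N : normal_in N setT -> normal_closure N = N.
Proof. by move=> nN; rewrite /normal_closure smallest_id. Qed.

End Subgroups.

Arguments group_center G : clear implicits.
Arguments torsion G : clear implicits.
Arguments lower_central_series G n : clear implicits.
Arguments nilpotent_group G : clear implicits.

Section QuotientGroup.
Variables (G : groupType) (N : set G).
Implicit Types x y z : G.

Local Open Scope quotient_scope.

Definition eqmod x y : bool := `[< normal_closure N (x^-1 * y) >].

Let ncl1 : normal_closure N 1.
Proof. by have [[]] := normal_in_normal_closure N. Qed.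

Let nclF x y :
  normal_closure N x -> normal_closure N y -> normal_closure N (x / y).
Proof. by have [[_ h] _ _ _] := normal_in_normal_closure N; apply: h. Qed.

Let nclV x : normal_closure N x -> normal_closure N x^-1.
Proof. by move=> Nx; rewrite -[x^-1]mul1g; apply: nclF. Qed.

Let nclM x y :
  normal_closure N x -> normal_closure N y -> normal_closure N (x * y).
Proof. by move=> Nx /nclV Ny; rewrite -[y]invgK; apply: nclF. Qed.

Let nclJ x y : normal_closure N x -> normal_closure N (x ^ y).
Proof.
by have [_ _ _ h] := normal_in_normal_closure N; move=> Nx; apply: h.
Qed.

Fact eqmod_refl : reflexive eqmod.
Proof. by move=> x; apply/asboolP; rewrite mulVg. Qed.

Fact eqmod_sym : symmetric eqmod.
Proof.
by move=> x y; apply/asboolP/asboolP => /nclV; rewrite invgM invgK.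
Qed.

Fact eqmod_trans : transitive eqmod.
Proof.
move=> y x z /asboolP xy /asboolP yz; apply/asboolP.
by have := nclM xy yz; rewrite -mulgA mulKVg.
Qed.

Canonical eqmod_equiv := EquivRel eqmod eqmod_refl eqmod_sym eqmod_trans.

(* The quotient of [G] by the normal closure of [N]; this is [G / N] as soon
   as [N] is a normal subgroup (see [normal_closure_id]). *)
Definition quotient_group : Type := {eq_quot eqmod_equiv}.

HB.instance Definition _ := Choice.on quotient_group.
HB.instance Definition _ := EqQuotient.on quotient_group.

Definition quotient_one : quotient_group := \pi_quotient_group 1.
Definition quotient_inv (a : quotient_group) : quotient_group :=
  \pi_quotient_group (repr a)^-1.
Definition quotient_mul (a b : quotient_group) : quotient_group :=
  \pi_quotient_group (repr a * repr b).

Let piP x y : reflect (normal_closure N (x^-1 * y))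
  (\pi_quotient_group x == \pi_quotient_group y).
Proof. by rewrite eqmodE; apply: asboolP. Qed.

Let reprP' x : normal_closure N ((repr (\pi_quotient_group x))^-1 * x).
Proof. by apply/piP; rewrite reprK. Qed.

Fact quotient_mulE x y :
  quotient_mul (\pi_quotient_group x) (\pi_quotient_group y) =
  \pi_quotient_group (x * y).
Proof.
apply/eqP/piP; set a := repr _; set b := repr _.
have -> : (a * b)^-1 * (x * y) = (a^-1 * x) ^ b * (b^-1 * y).
  by rewrite /conjg invgM !mulgA mulgK.
by apply: nclM; [apply: nclJ; apply: reprP' | apply: reprP'].
Qed.

Fact quotient_invE x :
  quotient_inv (\pi_quotient_group x) = \pi_quotient_group x^-1.
Proof.
apply/eqP/piP; set a := repr _; rewrite invgK.
have -> : a / x = (a^-1 * x)^-1 ^ x^-1.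
  by rewrite /conjg invgM !invgK !mulgA mulgV mul1g.
by apply: nclJ; apply: nclV; apply: reprP'.
Qed.

Fact quotient_mulA : associative quotient_mul.
Proof.
move=> a b c; rewrite -[a]reprK -[b]reprK -[c]reprK.
rewrite (quotient_mulE (repr b) (repr c)) (quotient_mulE (repr a) (repr b)).
by rewrite (quotient_mulE (repr a) (_ * _)) (quotient_mulE (_ * _)) mulgA.
Qed.

Fact quotient_mul1g : left_id quotient_one quotient_mul.
Proof. by move=> a; rewrite -[a]reprK quotient_mulE mul1g. Qed.

Fact quotient_mulg1 : right_id quotient_one quotient_mul.
Proof. by move=> a; rewrite -[a]reprK quotient_mulE mulg1. Qed.

Fact quotient_mulVg : left_inverse quotient_one quotient_inv quotient_mul.
Proof. by move=> a; rewrite -[a]reprK quotient_invE quotient_mulE mulVg. Qed.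

Fact quotient_mulgV : right_inverse quotient_one quotient_inv quotient_mul.
Proof. by move=> a; rewrite -[a]reprK quotient_invE quotient_mulE mulgV. Qed.

HB.instance Definition _ := isGroup.Build quotient_group
  quotient_mulA quotient_mul1g quotient_mulg1 quotient_mulVg quotient_mulgV.

Fact quotient_piM x y : \pi_quotient_group (x * y) =
  \pi_quotient_group x * \pi_quotient_group y.
Proof. by rewrite -quotient_mulE. Qed.

Fact quotient_pi_eq1 x :
  \pi_quotient_group x = 1 <-> normal_closure N x.
Proof.
rewrite -[X in normal_closure N X]invgK -[x^-1]mulg1.
split=> [/eqP/piP/nclV // | Nx]; apply/eqP/piP.
by rewrite -[_ * _]invgK; apply: nclV.
Qed.

End QuotientGroup.

Section ResidualFiniteness.
Variables (G : groupType) (S : set G).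

(* [w] is a word in the letters [S] and their inverses, spelling [x]. *)
Definition spells (w : seq G) (x : G) : Prop :=
  (forall s, s \in w -> S s \/ S s^-1) /\ \prod_(s <- w) s = x.

Definition word_length (x : G) : nat :=
  nat_min [set size w | w in spells ^~ x].

Definition residual_depth (x : G) : nat :=
  nat_min [set k | exists (Q : finGroupType) (phi : {multiplicative G -> Q}),
    [/\ set_surj [set: G] [set: Q] phi, phi x <> 1 & k = #|Q| ] ].

Definition residual_growth (n : nat) : nat :=
  nat_max [set residual_depth x | x in
    [set x : G | x <> 1 /\ (word_length x <= n)%N]].

End ResidualFiniteness.

Section GrowthComparison.
Local Open Scope ring_scope.
Variable R : realType.
Implicit Types f g : nat -> R.

(* The functions are compared on the positive integers only. *)
Definition growth_le f g : Prop :=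
  exists2 C : nat, (0 < C)%N &
    forall n : nat, (0 < n)%N -> f n <= C%:R * g (C * n)%N.

Definition growth_equiv f g : Prop := growth_le f g /\ growth_le g f.

End GrowthComparison.

(* Main.v *)
(* Upper bound.  An integral character of a subgroup V, occurring in a descending
   series of kernels of characters, extends to a function f on the whole group
   which is polynomial: it is killed by iterated differences.  If f x <> 0, then
   |f x| is polynomial in the length of x, hence some d = O(log n) does not divide
   f x; the normal subgroup of periods of f modulo d misses x, and it contains all
   E-th powers for some E = O(d), so its index is O(d ^ h).  If the center of
   G = Gamma / T has Hirsch length at least 2, it contains two isolated nontrivial
   subgroups A1, A2 with trivial intersection; a nontrivial element of G survives
   in one of the torsion-free groups G / A1, G / A2, of Hirsch length less than h.

   Lower bound.  If the center of G has Hirsch length 1, every nontrivial subgroup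
   V of G has a nonzero character obtained from an iterated commutator
   V -> Z(G), which maps N :&: V into N :&: Z(G) for all normal N.  If a finite
   quotient detects z ^ lcm(1, ..., M), z central, then nonzero elements of
   N :&: Z(G) have height more than M, and each of the h steps of the resulting
   series of kernels contributes a factor of order M to the index of N. *)
From HB Require Import structures.
Require Import Defs.
From mathcomp Require Import fingroup all_boot all_order all_algebra.
From mathcomp Require Import all_classical all_reals all_analysis.
From mathcomp Require Import zify ring lra.

Set Implicit Arguments.
Unset Strict Implicit.
Unset Printing Implicit Defensive.

Import Order.TTheory GRing.Theory Num.Theory.

Local Open Scope classical_set_scope.

(** * Subgroups and finite index *)

Section IntegerPowers.
Local Open Scope group_scope.
Variable G : groupType.
Implicit Types (x y : G) (m n : int).

(** Polynomials are forced: the centre of the integral Heisenberg group is generated by a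
    commutator, so none of its nonzero characters extends to a character of the group. The obstacle
    lies in climbing from a kernel M to V = <t> M: the natural lift involves conjugation by powers
    of t, which changes a function by one whose ordinary degree need not be lower. Measuring
    elements by their depth in the lower central series cures this, because [g, y] lies deeper than
    g. Both logarithms come from Chebyshev-type estimates: a positive common multiple of 1, ..., M
    is at least 2^(M-1), which yields a small non-divisor, while for M a power of 2 some common
    multiple is at most 4^M, which yields a short word that is hard to detect. Separation only
    concerns elements of infinite order; the torsion elements are finite in number and affect the
    constants alone. Accordingly A1 and A2 are isolated, so that an element surviving in a quotient
    has infinite order there. *)

Definition zpow x n : G :=
  match n with Posz k => x ^+ k | Negz k => x ^- k.+1 end.

Lemma zpow0 x : zpow x 0 = 1. Proof. by []. Qed.
Lemma zpow1 x : zpow x 1 = x. Proof. by []. Qed.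
Lemma zpow_nat x (k : nat) : zpow x k%:Z = x ^+ k. Proof. by []. Qed.

Lemma zpow_oppn x (k : nat) : zpow x (- k%:Z)%R = x ^- k.
Proof. by case: k => [|k] //=; rewrite ?invg1 // -NegzE. Qed.

Lemma zpowSr x n : zpow x (n + 1)%R = zpow x n * x.
Proof.
case: n => [k|k]; first by rewrite -PoszD addn1 /= expgSr.
rewrite NegzE.
have -> : (- k.+1%:Z + 1 = - k%:Z)%R by lia.
by rewrite !zpow_oppn expgS invgM mulgVK.
Qed.

Lemma zpowBr1 x n : zpow x (n - 1)%R = zpow x n * x^-1.
Proof. by rewrite -[in RHS](subrK 1%R n) zpowSr mulgK. Qed.

Lemma zpowD x m n : zpow x (m + n)%R = zpow x m * zpow x n.
Proof.
elim: n => [|n IH|n IH]; first by rewrite addr0 zpow0 mulg1.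
  by rewrite -addn1 PoszD addrA !zpowSr IH mulgA.
rewrite -addn1 PoszD opprD addrA !zpowBr1 IH.
by rewrite mulgA.
Qed.

Lemma zpowN x n : zpow x (- n)%R = (zpow x n)^-1.
Proof.
by apply/esym/mulg1_eq; rewrite -zpowD subrr zpow0.
Qed.

Lemma zpowMn x n (k : nat) : zpow x (n * k%:Z)%R = (zpow x n) ^+ k.
Proof.
elim: k => [|k IH]; first by rewrite mulr0.
by rewrite -addn1 PoszD mulrDr mulr1 zpowD IH addn1 expgSr.
Qed.

Lemma zpow_expg x (q : nat) n : zpow (x ^+ q) n = zpow x (n * q%:Z)%R.
Proof.
case: n => k; first by rewrite -PoszM /= mulnC expgnA.
by rewrite NegzE mulNr !zpowN -PoszM !zpow_nat mulnC expgnA.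
Qed.

End IntegerPowers.

Section Subgroups.
Local Open Scope group_scope.
Variable G : groupType.
Implicit Types (A B C H K M N U V : set G) (x y z : G).

Lemma subgroup1 H : subgroup H -> H 1. Proof. by case. Qed.

Lemma subgroupV H x : subgroup H -> H x -> H x^-1.
Proof. by move=> [H1 HF] Hx; rewrite -[x^-1]mul1g; apply: HF. Qed.

Lemma subgroupM H x y : subgroup H -> H x -> H y -> H (x * y).
Proof.
by move=> sH Hx Hy; rewrite -[y]invgK; apply: sH.2 => //; apply: subgroupV.
Qed.

Lemma subgroupVr H x : subgroup H -> H x^-1 -> H x.
Proof. by move=> sH /(subgroupV sH); rewrite invgK. Qed.

Lemma subgroupJ H x y : subgroup H -> H x -> H y -> H (x ^ y).
Proof.
by move=> sH Hx Hy; rewrite conjgE; do ?apply: subgroupM => //; apply: subgroupV.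
Qed.

Lemma subgroupX H x k : subgroup H -> H x -> H (x ^+ k).
Proof.
move=> sH Hx; elim: k => [|k IH]; first by rewrite expg0; apply: subgroup1.
by rewrite expgS; apply: subgroupM.
Qed.

Lemma subgroup_zpow H x n : subgroup H -> H x -> H (zpow x n).
Proof.
move=> sH Hx; case: n => k /=; first exact: subgroupX.
by apply: subgroupV => //; apply: subgroupX.
Qed.

Lemma subgroup_mull H x y : subgroup H -> H x -> H (x * y) -> H y.
Proof.
by move=> sH Hx Hxy; rewrite -(mulKg x y); apply: subgroupM => //; apply: subgroupV.
Qed.

Lemma subgroup_mulr H x y : subgroup H -> H y -> H (x * y) -> H x.
Proof. by move=> sH Hx Hxy; rewrite -(mulgK y x); apply: sH.2. Qed.

Lemma subgroupI H K : subgroup H -> subgroup K -> subgroup (H `&` K).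
Proof.
move=> [H1 HF] [K1 KF]; split=> // x y [Hx Kx] [Hy Ky].
by split; [apply: HF|apply: KF].
Qed.

Lemma subgroup_setT : subgroup [set: G]. Proof. by []. Qed.

Lemma subgroup_set1 : subgroup [set (1 : G)].
Proof. by split=> // x y -> ->; rewrite invg1 mulg1. Qed.

Lemma subgroup_generated S : subgroup (@generated_subgroup G S).
Proof.
split=> [A [[]] //|x y Hx Hy A [sA SA]].
by apply: sA.2; [apply: Hx|apply: Hy].
Qed.

Lemma sub_generated S : S `<=` @generated_subgroup G S.
Proof. exact: sub_smallest. Qed.

Lemma generated_min S H : subgroup H -> S `<=` H -> @generated_subgroup G S `<=` H.
Proof. by move=> sH SH x; apply. Qed.

Lemma subgroup_center : subgroup (group_center G).
Proof.
split=> [y|x y Zx Zy z]; first by rewrite mul1g mulg1.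
rewrite -mulgA; have -> : y^-1 * z = z * y^-1.
  by apply: (@mulgI _ y); rewrite mulVKg mulgA Zy mulgK.
by rewrite mulgA (Zx z) mulgA.
Qed.

Lemma normal_conjV H K x y : normal_in H K -> K y -> H (x ^ y) -> H x.
Proof.
case=> _ sK _ nH Ky Hxy; rewrite -(conjgK y x).
by apply: nH => //; apply: subgroupV.
Qed.

Lemma lcoset_setP H x y : subgroup H ->
  lcoset_set x H = lcoset_set y H <-> H (y^-1 * x).
Proof.
move=> sH; split=> [E|Hyx].
  have : lcoset_set y H x by rewrite -E; exists 1; [exact: subgroup1|rewrite mulg1].
  by case=> h Hh <-; rewrite mulKg.
apply/seteqP; split=> z [h Hh <-].
  exists (y^-1 * x * h); first exact: subgroupM.
  by rewrite !mulgA mulgV mul1g.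
exists ((y^-1 * x)^-1 * h); first by apply: subgroupM => //; apply: subgroupV.
by rewrite invgM invgK !mulgA mulgV mul1g.
Qed.

(** The representatives may lie outside [K], and [H] need not be contained in [K]. With [H =
    [set 1]] this says that [K] is finite. *)
Definition finite_index K H :=
  exists s : seq G, forall x, K x -> exists2 y, y \in s & H (y^-1 * x).

Lemma finite_lcosets K H : subgroup H ->
  finite_set (lcosets_in K H) <-> finite_index K H.
Proof.
move=> sH; split=> [fin|[s hs]].
  pose rep (A : set G) := xget 1 A.
  have /finite_seqP[s hs] := fin.
  exists [seq rep A | A <- s] => x Kx.
  have : lcosets_in K H (lcoset_set x H) by exists x.
  rewrite hs /= => xs; exists (rep (lcoset_set x H)); first exact: map_f.
  have : lcoset_set x H (rep (lcoset_set x H)).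
    by apply: (@xgetPex _ 1); exists x, 1; [exact: subgroup1|rewrite mulg1].
  case=> h Hh <-; rewrite invgM mulgVK; exact: subgroupV.
apply: (@sub_finite_set _ _ [set` [seq lcoset_set y H | y <- s]]); last first.
  exact: finite_seq.
move=> A [x Kx <-]; have [y ys Hy] := hs _ Kx.
apply/mapP; exists y => //; exact/lcoset_setP.
Qed.

Lemma cyclic_quotientP K H : subgroup H ->
  cyclic_quotient K H <->
  exists2 x, K x & forall y, K y -> exists n, H (zpow x n * y).
Proof.
move=> sH; split=> -[x Kx hx]; exists x => // y Ky; have [n hn] := hx y Ky.
  case: hn => /lcoset_setP hn.
    by exists (- n%:Z)%R; rewrite zpow_oppn; apply: hn.
  by exists (Posz n); have := hn sH; rewrite invgK.
case: n hn => k /= hn.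
  by exists k; right; apply/lcoset_setP => //; rewrite invgK.
by exists k.+1; left; apply/lcoset_setP.
Qed.

Lemma finite_index_subset A B C : B `<=` C -> finite_index A B -> finite_index A C.
Proof. by move=> BC [s hs]; exists s => x /hs[y ys /BC]; exists y. Qed.

Lemma finite_index_subl A B C : A `<=` B -> finite_index B C -> finite_index A C.
Proof. by move=> AB [s hs]; exists s => x /AB/hs. Qed.

Lemma finite_index_trans A B C :
  finite_index A B -> finite_index B C -> finite_index A C.
Proof.
move=> [s hs] [r hr]; exists [seq y * z | y <- s, z <- r] => x /hs[y ys] /hr[z zr].
by rewrite mulgA => Cx; exists (y * z); [exact: allpairs_f|rewrite invgM].
Qed.

End Subgroups.

(** * Hirsch length *)

Section HirschLength.
Local Open Scope group_scope.
Variable G : groupType.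
Implicit Types (A B C H K M N U V : set G) (x y z : G).

(** The series grows from the bottom, one factor at a time, so that proofs go by induction on it;
    the boolean counts the new factor when it is infinite. *)
Inductive polycyclic : set G -> nat -> Prop :=
| polycyclic1 : polycyclic [set 1] 0
| polycyclicS M K k : polycyclic M k -> normal_in M K -> cyclic_quotient K M ->
    polycyclic K (`[< ~ finite_index K M >] + k).

Lemma polycyclic_subgroup K k : polycyclic K k -> subgroup K.
Proof. by case=> [|M {}K {}k _ []//]; exact: subgroup_set1. Qed.

Lemma infinite_lcosets K H : subgroup H ->
  `[< infinite_set (lcosets_in K H) >] = `[< ~ finite_index K H >].
Proof.
move=> sH; apply/asboolP/asboolP => h.
  by move/(finite_lcosets _ sH).
by move=> /(finite_lcosets _ sH).
Qed.

Lemma hirsch_sum n (L : nat -> set G) :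
  #|[pred i : 'I_n | `[< infinite_set (lcosets_in (L i.+1) (L i)) >]]| =
  \sum_(i < n) (`[< infinite_set (lcosets_in (L i.+1) (L i)) >] : nat).
Proof. by rewrite -sum1_card big_mkcond. Qed.

Lemma has_hirsch_lengthP K k : has_hirsch_length K k <-> polycyclic K k.
Proof.
split.
  move=> [n [L [[L0 <- LS] ->]]]; rewrite hirsch_sum.
  elim: n LS => [|n IH] LS; first by rewrite big_ord0 L0; exact: polycyclic1.
  have [nL cL] := LS n (ltnSn n).
  rewrite big_ord_recr /= addnC infinite_lcosets; last by case: nL.
  by apply: polycyclicS => //; apply: IH => i /ltnW; apply: LS.
elim=> [|M {}K {}k _ [n [L [[L0 Ln LS] ->]]] nM cM].
  by exists 0%N, (fun=> [set 1]); split=> //; rewrite eq_card0 // => -[].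
exists n.+1, (fun i => if (i <= n)%N then L i else K); split.
  split=> //; first by rewrite ltnn.
  move=> i; rewrite ltnS => le_in; rewrite le_in.
  by case: ltngtP le_in => // [/LS|->]; rewrite ?Ln.
rewrite hirsch_sum (hirsch_sum _ (fun i => if (i <= n)%N then L i else K)).
rewrite big_ord_recr /= leqnn ltnn addnC.
rewrite Ln infinite_lcosets; last by case: nM.
congr addn; apply: eq_bigr => i _.
by rewrite ltn_ord (ltnW (ltn_ord i)).
Qed.

Section Degree.
Variables (M K : set G) (x : G).
Hypotheses (nM : normal_in M K) (Kx : K x).

Let sM : subgroup M. Proof. by case: nM. Qed.
Let sK : subgroup K. Proof. by case: nM. Qed.

(** [M (zpow x n * y)] reads as y = x^(-n) modulo [M]: the exponent stands for the class of [y] in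
    the cyclic quotient, and it is additive in [y]. *)
Lemma zpow_cosetM y z m n : K y -> M (zpow x m * y) -> M (zpow x n * z) ->
  M (zpow x (m + n)%R * (y * z)).
Proof.
move=> Ky My Mz.
have -> : zpow x (m + n)%R * (y * z) =
    (zpow x m * y) ^ (zpow x n)^-1 * (zpow x n * z).
  by rewrite addrC zpowD conjgE invgK !mulgA mulgVK.
apply: subgroupM => //; case: nM => _ _ _; apply=> //.
by apply: subgroupV => //; apply: subgroup_zpow.
Qed.

Lemma zpow_cosetV y n : K y -> M (zpow x n * y) -> M (zpow x (- n)%R * y^-1).
Proof.
move=> Ky My; rewrite zpowN -invgM; apply: subgroupV => //.
have -> : y * zpow x n = (zpow x n * y) ^ (zpow x n).
  by rewrite conjgE -!mulgA mulKg.
case: nM => _ _ _; apply=> //; exact: subgroup_zpow.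
Qed.

Lemma zpow_coset_zpow y m n : K y -> M (zpow x n * y) ->
  M (zpow x (n * m)%R * zpow y m).
Proof.
move=> Ky My.
have pos (k : nat) : M (zpow x (n * k%:Z)%R * zpow y k%:Z).
  elim: k => [|k IH]; first by rewrite mulr0 !zpow0 mulg1; apply: subgroup1.
  rewrite -addn1 PoszD mulrDr mulr1 (zpowD y) zpow1; apply: zpow_cosetM => //.
  exact: subgroup_zpow.
case: (intP m) => [|k|k]; [exact: (pos 0%N)|exact: pos|].
rewrite mulrN (zpowN y); apply: zpow_cosetV; last exact: pos.
exact: subgroup_zpow.
Qed.

End Degree.

Lemma finite_index_setI H K M : subgroup H -> subgroup M -> finite_index K M ->
  finite_index (H `&` K) (H `&` M).
Proof.
move=> sH sM [s hs].
pose r y := xget 1 [set z | (H `&` K) z /\ M (y^-1 * z)].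
exists [seq r y | y <- s] => x [Hx Kx]; have [y ys My] := hs x Kx.
exists (r y); first exact: map_f.
have [[Hr _] Mr] : [set z | (H `&` K) z /\ M (y^-1 * z)] (r y).
  by apply: (@xgetPex _ 1); exists x.
split; first by apply: subgroupM => //; apply: subgroupV.
have -> : (r y)^-1 * x = (y^-1 * r y)^-1 * (y^-1 * x).
  by rewrite invgM invgK mulgA mulgK.
by apply: subgroupM => //; apply: subgroupV.
Qed.

Lemma normal_in_setI H K M : subgroup H -> normal_in M K ->
  normal_in (H `&` M) (H `&` K).
Proof.
move=> sH [sM sK MK nM]; split; do ?exact: subgroupI.
- by move=> x [Hx /MK].
- by move=> x y [Hx Mx] [Hy Ky]; split; [exact: subgroupJ|exact: nM].
Qed.

Lemma cyclic_quotient_setI H K M : subgroup H -> normal_in M K ->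
  cyclic_quotient K M -> cyclic_quotient (H `&` K) (H `&` M).
Proof.
move=> sH nM; have [sM sK MK _] := nM => /(cyclic_quotientP K sM)[x Kx hx].
apply/cyclic_quotientP; first exact: subgroupI.
(* The exponents of [x] that occur for elements of [H] form a subgroup of the integers, generated by
   its least positive element. If there is none, [H] meets [K] inside [M]. *)
pose P (n : nat) := `[< (0 < n)%N /\
   exists2 y, (H `&` K) y & M (zpow x n%:Z * y) >].
have [exP|noP] := pselect (exists n, P n); last first.
  exists 1; first by split; exact: subgroup1.
  move=> y [Hy Ky]; exists 0; rewrite zpow0 mul1g; split=> //.
  have [n Mn] := hx y Ky.
  case: (intP n) Mn => [|k|k] Mn; first by rewrite zpow0 mul1g in Mn.
    by case: noP; exists k.+1; apply/asboolP; split=> //; exists y.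
  case: noP; exists k.+1; apply/asboolP; split=> //; exists y^-1.
    by split; exact: subgroupV.
  by rewrite -[Posz _]opprK; exact: (zpow_cosetV nM).
have [m [m0 [y0 [Hy0 Ky0] My0]] minP] : exists2 m : nat,
    (0 < m)%N /\ (exists2 y, (H `&` K) y & M (zpow x m%:Z * y)) &
    forall n, P n -> (m <= n)%N.
  by case: (ex_minnP exP) => m /asboolP Pm minP; exists m.
exists y0 => // y [Hy Ky]; have [n Mn] := hx y Ky.
pose q := (n %/ m%:Z)%Z.
have Ky0q : K (zpow y0 (- q)%R) by exact: subgroup_zpow.
have Hy0q : H (zpow y0 (- q)%R) by exact: subgroup_zpow.
have Mr : M (zpow x (n %% m%:Z)%Z * (y * zpow y0 (- q)%R)).
  have -> : (n %% m%:Z)%Z = (n + m%:Z * (- q))%R.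
    by rewrite [in RHS](divz_eq n m%:Z) /q; ring.
  by apply: (zpow_cosetM nM) => //; exact: (zpow_coset_zpow nM Kx).
have r_lt : ((n %% m%:Z)%Z < m%:Z)%R by apply: ltz_pmod; rewrite ltz_nat.
have r_ge : (0 <= (n %% m%:Z)%Z)%R by apply: modz_ge0; rewrite gt_eqF // ltz_nat.
case: (n %% m%:Z)%Z r_lt r_ge Mr => // r r_lt _ Mr.
have r0 : r = 0%N.
  case: (posnP r) => // r_gt0.
  have /minP : P r.
    apply/asboolP; split=> //; exists (y * zpow y0 (- q)%R) => //.
    by split; apply: subgroupM.
  by move: r_lt; rewrite ltz_nat => r_lt; rewrite leqNgt r_lt.
rewrite r0 zpow0 mul1g in Mr.
exists (- q)%R; split; first exact: subgroupM.
apply: (normal_conjV nM Ky0q).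
by rewrite conjgE -mulgA mulKg.
Qed.

(** Intersecting with [H] replaces each factor by a subgroup of it, so no new infinite factor
    appears. If none is lost, every infinite cyclic factor is met in a nontrivial subgroup, which
    has finite index. *)
Lemma polycyclic_setI K k H : polycyclic K k -> subgroup H ->
  exists k', [/\ polycyclic (H `&` K) k', (k' <= k)%N &
    k' = k -> finite_index K (H `&` K)].
Proof.
move=> pK sH; elim: pK => [|M {}K {}k pM [k' [pk' le_k' eq_k']] nM cM].
  exists 0%N; have -> : H `&` [set 1] = [set 1].
    by rewrite setIC; apply: setIidl => x ->; exact: subgroup1.
  split=> //; first exact: polycyclic1.
  by move=> _; exists [:: 1] => x ->; exists 1; rewrite ?inE //= invg1 mulg1.
have [sM sK MK _] := nM.
exists (`[< ~ finite_index (H `&` K) (H `&` M) >] + k')%N; split.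
- apply: polycyclicS => //; first exact: normal_in_setI.
  exact: cyclic_quotient_setI.
- apply: leq_add => //; case: asboolP => // h; case: asboolP => // /contrapT h'.
  by case: h; apply: finite_index_setI.
have subI : H `&` M `<=` H `&` K by apply: setIS.
case: asboolP => hH; case: asboolP => hK /=; rewrite ?add0n ?add1n.
(* Both factors are infinite: some [y0] in [H] has a nonzero exponent [m], and the representatives
   over [M] multiplied by |m| powers of [x] suffice. *)
- move=> [/eq_k' finM].
  have [y0 [[Hy0 Ky0] nMy0]] : exists y0, (H `&` K) y0 /\ ~ M y0.
    apply: contrapT => hno; apply: hH.
    exists [:: 1] => x HKx; exists 1; rewrite ?inE // invg1 mul1g.
    split; first by case: HKx.
    by apply: contrapT => nMx; apply: hno; exists x.
  have /(cyclic_quotientP _ sM)[x Kx hx] := cM.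
  have [m Mm] := hx _ Ky0.
  have m0 : m != 0%R.
    by apply: contra_notN nMy0 => /eqP m0; rewrite m0 zpow0 mul1g in Mm.
  have [s hs] := finM.
  exists [seq (zpow x r%:Z)^-1 * y | r <- iota 0 `|m|, y <- s] => y Ky.
  have [n Mn] := hx _ Ky.
  pose q := (n %/ m)%Z.
  have Ky0q : K (zpow y0 (- q)%R) by exact: subgroup_zpow.
  have Hy0q : H (zpow y0 (- q)%R) by exact: subgroup_zpow.
  have : M (zpow x (n %% m)%Z * (y * zpow y0 (- q)%R)).
    have -> : (n %% m)%Z = (n + m * (- q))%R.
      by rewrite [in RHS](divz_eq n m) /q; ring.
    by apply: (zpow_cosetM nM) => //; exact: (zpow_coset_zpow nM Kx).
  have r_lt : ((n %% m)%Z < `|m|)%R by rewrite ltz_mod.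
  have r_ge : (0 <= (n %% m)%Z)%R by rewrite modz_ge0.
  case: (n %% m)%Z r_lt r_ge => // r r_lt _ /hs [z zs [Hz Mz]].
  exists ((zpow x r%:Z)^-1 * z).
    by apply: allpairs_f => //; rewrite mem_iota /= add0n -ltz_nat.
  have -> : ((zpow x r%:Z)^-1 * z)^-1 * y =
      (z^-1 * (zpow x r%:Z * (y * zpow y0 (- q)%R))) * (zpow y0 (- q)%R)^-1.
    by rewrite invgM invgK !mulgA mulgK.
  have HK : subgroup (H `&` K) by exact: subgroupI.
  apply: HK.2; first by split=> //; exact: MK.
  by split.
- by case: hH; apply: finite_index_setI => //; exact: contrapT.
- by move=> e; move: le_k'; rewrite e ltnn.
- move=> /eq_k' finM; have finK : finite_index K M by exact: contrapT.
  exact: finite_index_subset subI (finite_index_trans finK finM).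
Qed.

(** The Hirsch length is the largest length of such a chain. This description does not mention a
    series, whence uniqueness. *)
Inductive infinite_index_chain : set G -> nat -> Prop :=
| infinite_index_chain0 K : infinite_index_chain K 0
| infinite_index_chainS H K n : subgroup H -> H `<=` K -> ~ finite_index K H ->
    infinite_index_chain H n -> infinite_index_chain K n.+1.

Lemma infinite_index_chain_le K n k :
  infinite_index_chain K n -> polycyclic K k -> (n <= k)%N.
Proof.
move=> cK; elim: cK k => // H {}K {}n sH HK infH _ IH k pK.
have [k' []] := polycyclic_setI pK sH.
rewrite setIidl // => /IH le_nk le_k' eq_k'.
apply: leq_ltn_trans le_nk _; rewrite ltn_neqAle le_k' andbT.
by apply/eqP => /eq_k'.
Qed.

Lemma infinite_index_chain_sub H K n : H `<=` K ->
  infinite_index_chain H n -> infinite_index_chain K n.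
Proof.
move=> HK cH; case: cH HK => [H' _|U H' {}n sU UH infU cU HK].
  exact: infinite_index_chain0.
apply: infinite_index_chainS (cU) => //; first exact: subset_trans HK.
by apply: contra_not infU; apply: finite_index_subl.
Qed.

Lemma polycyclic_chain K k : polycyclic K k -> infinite_index_chain K k.
Proof.
elim=> [|M {}K {}k _ IH [sM sK MK _] _]; first exact: infinite_index_chain0.
case: asboolP => h; last exact: infinite_index_chain_sub IH.
exact: infinite_index_chainS IH.
Qed.

Lemma polycyclic_uniq K k k' : polycyclic K k -> polycyclic K k' -> k = k'.
Proof.
move=> p p'; apply/eqP; rewrite eqn_leq.
rewrite (infinite_index_chain_le (polycyclic_chain p) p').
exact: (infinite_index_chain_le (polycyclic_chain p') p).
Qed.

Lemma hirsch_lengthP K k : polycyclic K k -> hirsch_length K = k.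
Proof.
move=> pK; rewrite /hirsch_length; case: xgetP => [k' _ /has_hirsch_lengthP|].
  by move=> /polycyclic_uniq; apply.
by move=> /(_ k) []; apply/has_hirsch_lengthP.
Qed.

Lemma finite_group_polycyclic K k : polycyclic K k ->
  finite_index K [set 1] -> k = 0%N.
Proof.
move=> pK finK; apply/eqP; rewrite -leqn0.
case: k pK => // k /polycyclic_chain cK.
exfalso; inversion cK as [|H ? ? sH HK infH]; subst; apply: infH.
by apply: finite_index_subset finK => x ->; exact: subgroup1.
Qed.

Lemma polycyclic0_finite K : polycyclic K 0 -> finite_index K [set 1].
Proof.
move=> pK; apply: contrapT => infK.
have : (1 <= 0)%N; last by [].
apply: (infinite_index_chain_le _ pK).
apply: infinite_index_chainS infK (infinite_index_chain0 _).
  exact: subgroup_set1.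
by move=> x ->; apply: subgroup1; exact: polycyclic_subgroup pK.
Qed.

End HirschLength.

(** * Characters to the integers and the torsion subgroup *)

Section IntegerCharacters.
Local Open Scope group_scope.
Variable G : groupType.
Implicit Types (A B C H K M N U V : set G) (x y z : G) (lam : G -> int).

Definition additive_on V lam :=
  forall x y, V x -> V y -> lam (x * y) = (lam x + lam y)%R.

Definition kernel_on V lam : set G := [set x | V x /\ lam x = 0%R].

Section AdditiveOn.
Variables (V : set G) (lam : G -> int).
Hypotheses (sV : subgroup V) (aV : additive_on V lam).

Lemma additive_on1 : lam 1 = 0%R.
Proof.
have := aV (subgroup1 sV) (subgroup1 sV); rewrite mulg1 => e.
by apply: (@addrI _ (lam 1)); rewrite -e addr0.
Qed.

Lemma additive_onV x : V x -> lam x^-1 = (- lam x)%R.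
Proof.
move=> Vx; apply: (@addrI _ (lam x)).
by rewrite -aV //; [rewrite mulgV subrr additive_on1|exact: subgroupV].
Qed.

Lemma additive_on_zpow x n : V x -> lam (zpow x n) = (n * lam x)%R.
Proof.
move=> Vx.
have pos (k : nat) : lam (zpow x k%:Z) = (k%:Z * lam x)%R.
  elim: k => [|k IH]; first by rewrite zpow0 additive_on1 mul0r.
  rewrite -addn1 PoszD zpowD aV ?zpow1 ?IH ?mulrDl ?mul1r //.
  exact: subgroup_zpow.
case: (intP n) => [|k|k]; [exact: (pos 0%N)|exact: pos|].
by rewrite zpowN additive_onV ?pos ?mulNr //; exact: subgroup_zpow.
Qed.

Lemma additive_onJ x y : V x -> V y -> lam (x ^ y) = lam x.
Proof.
move=> Vx Vy; rewrite conjgE !aV ?additive_onV //; first by ring.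
  exact: subgroupV.
exact: subgroupM.
Qed.

Lemma normal_in_kernel_on : normal_in (kernel_on V lam) V.
Proof.
split=> //; [|by move=> x []|].
  split=> [|x y [Vx lx] [Vy ly]]; first by split; [exact: subgroup1|exact: additive_on1].
  split; first exact: sV.2.
  by rewrite aV ?additive_onV ?lx ?ly //; exact: subgroupV.
by move=> x y [Vx lx] Vy; split; [exact: subgroupJ|rewrite additive_onJ].
Qed.

Lemma infinite_index_kernel_on t : V t -> lam t = 1%R ->
  ~ finite_index V (kernel_on V lam).
Proof.
move=> Vt lt [s hs].
have [B hB] : exists B : nat, forall y, y \in s -> (lam y <= B%:Z)%R.
  elim: {hs}s => [|y s [B hB]]; first by exists 0%N.
  exists (`|lam y| + B)%N => z; rewrite inE => /orP[/eqP->|/hB]; lia.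
have [y ys [Vy ly]] := hs (zpow t B.+1%:Z) (subgroup_zpow _ sV Vt).
have Vy' : V y.
  apply: (subgroupVr sV); apply: (subgroup_mulr sV _ Vy).
  exact: subgroup_zpow.
move: ly; rewrite aV ?additive_onV ?additive_on_zpow //; first last.
- exact: subgroup_zpow.
- exact: subgroupV.
by rewrite lt mulr1 => ly; have := hB _ ys; lia.
Qed.

Lemma polycyclic_kernel_on t k : V t -> lam t = 1%R -> polycyclic V k ->
  exists2 k', k = k'.+1 & polycyclic (kernel_on V lam) k'.
Proof.
move=> Vt lt pV.
have nker := normal_in_kernel_on; have [sker _ kerV _] := nker.
have [k' [pk' _ _]] := polycyclic_setI pV sker.
rewrite (setIidl kerV) in pk'.
exists k' => //; apply: (polycyclic_uniq pV).
have := @polycyclicS _ _ V _ pk' nker.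
rewrite (asboolT (infinite_index_kernel_on Vt lt)); apply.
apply/cyclic_quotientP => //; exists t => // y Vy; exists (- lam y)%R; split.
  by apply: subgroupM => //; exact: subgroup_zpow.
rewrite aV // ?additive_on_zpow // ?lt; last exact: subgroup_zpow.
by rewrite mulr1 addNr.
Qed.

(** The image of the character is generated by its least positive value [c]; dividing by [c] makes
    the character surjective. *)
Lemma additive_on_normalize x0 : V x0 -> lam x0 != 0%R ->
  exists lam' (c : nat), [/\ (0 < c)%N, additive_on V lam',
    forall x, V x -> lam x = (c%:Z * lam' x)%R & exists2 t, V t & lam' t = 1%R].
Proof.
move=> Vx0 l0.
pose P (n : nat) := `[< (0 < n)%N /\ exists2 x, V x & lam x = Posz n >].
have exP : exists n, P n.
  exists `|lam x0|%N; apply/asboolP; split; first by rewrite absz_gt0.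
  case: (lerP 0 (lam x0)) => h; first by exists x0 => //; lia.
  by exists x0^-1; [exact: subgroupV|rewrite additive_onV //; lia].
case: (ex_minnP exP) => c /asboolP[c0 [t Vt lt]] minP.
have cdvd x : V x -> lam x = (c%:Z * (lam x %/ c%:Z)%Z)%R.
  move=> Vx; set q := (lam x %/ c%:Z)%Z.
  have r_lt : ((lam x %% c%:Z)%Z < c%:Z)%R by apply: ltz_pmod; rewrite ltz_nat.
  have r_ge : (0 <= (lam x %% c%:Z)%Z)%R by apply: modz_ge0; rewrite gt_eqF // ltz_nat.
  have e := divz_eq (lam x) c%:Z.
  have lr : lam (x * zpow t (- q)%R) = (lam x %% c%:Z)%Z.
    rewrite aV ?additive_on_zpow ?lt //; last exact: subgroup_zpow.
    by rewrite [in LHS]e -/q; ring.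
  case: (lam x %% c%:Z)%Z r_lt r_ge lr e => // r r_lt _ lr e.
  rewrite -/q in e.
  case: (posnP r) => [r0|r_gt0]; first by rewrite [LHS]e r0 addr0 mulrC.
  have /minP : P r.
    apply/asboolP; split=> //; exists (x * zpow t (- q)%R) => //.
    by apply: subgroupM => //; exact: subgroup_zpow.
  by move: r_lt; rewrite ltz_nat => r_lt; rewrite leqNgt r_lt.
have cN0 : Posz c != 0%R by rewrite gt_eqF // ltz_nat.
exists (fun x => (lam x %/ c%:Z)%Z), c; split=> //.
- move=> x y Vx Vy; apply: (mulfI cN0).
  rewrite -cdvd; last exact: subgroupM.
  by rewrite mulrDr -!cdvd // aV.
- by exists t => //; rewrite lt divzz cN0.
Qed.

End AdditiveOn.

Lemma lower_central_iter x y j :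
  lower_central_series G j (iter j (fun m => [~ m, x]) y).
Proof.
elim: j => //= j IH; apply: sub_generated.
by exists (iter j (fun m => [~ m, x]) y), x.
Qed.

(** Conjugation by [x] acts on the characters of [M] unipotently, by nilpotency, and with finite
    order, since x^q lies in [M] and acts trivially. On a torsion-free abelian group such an action
    is trivial. *)
Lemma additive_on_invariant M x q lam : nilpotent_group G -> subgroup M ->
  (forall m, M m -> M (m ^ x)) -> (0 < q)%N -> M (x ^+ q) ->
  additive_on M lam -> forall m, M m -> lam (m ^ x) = lam m.
Proof.
move=> [c nil] sM Mx q0 Mq aM.
have McJ m : M m -> M [~ m, x].
  by move=> Mm; rewrite commgEl; apply: subgroupM (Mx _ Mm) => //; exact: subgroupV.
have lamR lam' m : additive_on M lam' -> M m ->
    lam' (m ^ x) = (lam' m + lam' [~ m, x])%R.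
  by move=> aM' Mm; rewrite -aM' //; [rewrite commgEl mulKVg|exact: McJ].
have aR lam' : additive_on M lam' -> additive_on M (fun m => lam' [~ m, x]).
  move=> aM' m n Mm Mn /=.
  have := lamR lam' (m * n) aM' (subgroupM sM Mm Mn).
  rewrite conjMg (aM' (m ^ x)) ?(aM' m n) //; [rewrite !lamR //; lia|exact: Mx|exact: Mx].
(* [(1 + d) ^ q = 1] and [d ^ 2 = 0] force [q d = 0]. *)
have step lam' : additive_on M lam' ->
    (forall m, M m -> lam' [~ [~ m, x], x] = 0%R) ->
    forall m, M m -> lam' [~ m, x] = 0%R.
  move=> aM' dd m Mm.
  have lamX k : M (m ^ x ^+ k) /\
      lam' (m ^ x ^+ k) = (lam' m + k%:Z * lam' [~ m, x])%R /\
      lam' [~ m ^ x ^+ k, x] = lam' [~ m, x].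
    elim: k => [|k [Mk [e1 e2]]]; first by rewrite expg0 conjg1 mul0r addr0.
    rewrite expgSr conjgM; split; first exact: Mx.
    rewrite lamR // e1 e2 -addn1 PoszD; split; first by ring.
    have := lamR _ _ (aR _ aM') Mk; rewrite /= => ->.
    by rewrite e2 dd // addr0.
  have [_ [+ _]] := lamX q.
  rewrite (additive_onJ sM aM' Mm Mq) => /eqP.
  rewrite -subr_eq0 opprD addrA subrr add0r oppr_eq0 mulf_eq0.
  by case/orP => /eqP //; lia.
have key j : (0 < j)%N -> forall lam', additive_on M lam' ->
    (forall m, M m -> lam' (iter j (fun m => [~ m, x]) m) = 0%R) ->
    forall m, M m -> lam' [~ m, x] = 0%R.
  case: j => // j _; elim: j => [|j IH] lam' aM' h //.
  apply: step => // m Mm; apply: (IH (fun m => lam' [~ m, x]) (aR _ aM')) => //.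
move=> m Mm; rewrite lamR // (key c.+1) ?addr0 // => n Mn.
have := lower_central_iter x n c; rewrite nil /= => ->.
by rewrite comm1g (additive_on1 sM).
Qed.

Lemma finite_index_cyclic M K x q : normal_in M K -> K x ->
  (forall y, K y -> exists n, M (zpow x n * y)) -> (0 < q)%N -> M (x ^+ q) ->
  finite_index K M.
Proof.
move=> nM Kx hx q0 Mq; have [sM _ _ _] := nM.
exists [seq (zpow x r%:Z)^-1 | r <- iota 0 q] => y Ky; have [n Mn] := hx y Ky.
have r_lt : ((n %% q%:Z)%Z < q%:Z)%R by apply: ltz_pmod; rewrite ltz_nat.
have r_ge : (0 <= (n %% q%:Z)%Z)%R by apply: modz_ge0; rewrite gt_eqF // ltz_nat.
have e := divz_eq n q%:Z.
case: (n %% q%:Z)%Z r_lt r_ge e => // r r_lt _ e.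
exists (zpow x r%:Z)^-1.
  by apply/mapP; exists r => //; rewrite mem_iota.
rewrite invgK; apply: (subgroup_mull (x := zpow (x ^+ q) (n %/ q%:Z)%Z) sM).
  exact: subgroup_zpow.
rewrite mulgA zpow_expg -zpowD -e //.
Qed.

(** If the top cyclic factor is infinite, the exponent of its generator is a character. If it is
    finite, a character of the lower term is invariant under [x] and extends after multiplication by
    [q]. *)
Lemma exists_character_nonzero V k : nilpotent_group G -> polycyclic V k ->
  ~ finite_index V [set 1] ->
  exists2 lam, additive_on V lam & exists2 t, V t & lam t != 0%R.
Proof.
move=> nilG; elim=> [|M K {}k pM IH nM cM] infK.
  by case: infK; exists [:: 1] => x ->; exists 1; rewrite ?inE // invg1 mulg1.
have [sM sK MK nMK] := nM.
have /(cyclic_quotientP _ sM)[x Kx hx] := cM.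
have [[q q0 Mq]|noq] := pselect (exists2 q, (0 < q)%N & M (x ^+ q)).
  have finK := finite_index_cyclic nM Kx hx q0 Mq.
  have [|lam aM [t Mt lt]] := IH.
    by apply: contra_not infK; apply: finite_index_trans.
  have inv n m : M m -> lam (m ^ zpow x n) = lam m.
    have pos (i : nat) m' : M m' -> lam (m' ^ zpow x i%:Z) = lam m'.
      elim: i m' => [|i IHi] m' Mm'; first by rewrite conjg1.
      rewrite -addn1 PoszD addrC zpowD conjgM zpow1.
      rewrite IHi; last exact: nMK.
      by apply: additive_on_invariant q0 Mq aM _ Mm' => // y My; exact: nMK.
    move=> Mm; case: (intP n) => [|i|i]; [exact: (pos 0%N)|exact: pos|].
    rewrite -[m in RHS](conjgKV (zpow x i.+1%:Z)) pos -?zpowN //.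
    by apply: nMK => //; exact: subgroup_zpow.
  have [f hf] : exists f : G -> int, forall y, K y -> M (zpow x (- f y)%R * y).
    have : forall y, exists n, K y -> M (zpow x (- n)%R * y).
      move=> y; have [Ky|nKy] := pselect (K y); last by exists 0%R.
      by have [n Mn] := hx y Ky; exists (- n)%R; rewrite opprK.
    by move=> /choice[f hf]; exists f.
  (* This is [q] times the rational extension of [lam] that sends [x] to lam(x^q) / q. *)
  pose mu y := (f y * lam (x ^+ q)%g + q%:Z * lam (zpow x (- f y)%R * y)%g)%R.
  have muE n m : M m -> mu (zpow x n * m) = (n * lam (x ^+ q)%g + q%:Z * lam m)%R.
    move=> Mm; rewrite /mu; set y := zpow x n * m.
    have Ky : K y by apply: subgroupM; [|exact: subgroup_zpow|exact: MK].
    have Mnf : M (zpow x (n - f y)%R).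
      apply: (subgroup_mulr sM Mm).
      by have := hf _ Ky; rewrite /y mulgA -zpowD addrC.
    have -> : zpow x (- f y)%R * y = zpow x (n - f y)%R * m.
      by rewrite /y mulgA -zpowD addrC.
    rewrite aM // mulrDr addrA; congr (_ + _)%R.
    have := additive_on_zpow sM aM q%:Z Mnf.
    rewrite zpow_nat -zpowMn => e; rewrite -e.
    rewrite -zpow_expg.
    by rewrite (additive_on_zpow sM aM) //; ring.
  have decomp y : K y -> exists n m, M m /\ y = zpow x n * m.
    move=> Ky; exists (f y), (zpow x (- f y)%R * y); split; first exact: hf.
    by rewrite mulgA -zpowD subrr zpow0 mul1g.
  exists mu.
    move=> y z /decomp[n [m [Mm ->]]] /decomp[n' [m' [Mm' ->]]].
    have Mmx : M (m ^ zpow x n') by apply: nMK => //; exact: subgroup_zpow.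
    have -> : zpow x n * m * (zpow x n' * m') =
        zpow x (n + n')%R * (m ^ zpow x n' * m').
      by rewrite zpowD conjgE !mulgA mulgK.
    rewrite !muE //; last exact: subgroupM.
    by rewrite aM // inv //; ring.
  exists t; first exact: MK.
  by rewrite -[t]mul1g -(zpow0 x) muE // mul0r add0r mulf_neq0 // gt_eqF // ltz_nat.
have uniq n m y : M (zpow x n * y) -> M (zpow x m * y) -> n = m.
  move=> Mn Mm.
  have Mnm : M (zpow x (n - m)%R).
    have := sM.2 _ _ Mn Mm; rewrite invgM mulgA mulgK.
    by rewrite zpowD zpowN.
  apply: contrapT => /eqP; rewrite -subr_eq0 => nm; apply: noq.
  case: (intP (n - m)%R) nm Mnm => // i _ Mi; exists i.+1 => //.
  by apply: (subgroupVr sM); move: Mi; rewrite zpowN.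
have [f hf] : exists f : G -> int, forall y, K y -> M (zpow x (- f y)%R * y).
  have : forall y, exists n, K y -> M (zpow x (- n)%R * y).
    move=> y; have [Ky|nKy] := pselect (K y); last by exists 0%R.
    by have [n Mn] := hx y Ky; exists (- n)%R; rewrite opprK.
  by move=> /choice[f hf]; exists f.
exists f.
  move=> y z Ky Kz; apply: oppr_inj; apply: (uniq _ _ (y * z)).
    exact: hf (subgroupM sK Ky Kz).
  by rewrite opprD; apply: (zpow_cosetM nM Kx) => //; exact: hf.
exists x => //; suff -> : f x = 1%R by [].
apply: oppr_inj; apply: (uniq _ _ x); first exact: hf.
by rewrite zpowN zpow1 mulVg; exact: subgroup1.
Qed.

Lemma exists_character V k : nilpotent_group G -> polycyclic V k ->
  ~ finite_index V [set 1] ->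
  exists2 lam, additive_on V lam & exists2 t, V t & lam t = 1%R.
Proof.
move=> nilG pV infV.
have [lam aV [t Vt lt]] := exists_character_nonzero nilG pV infV.
have [mu [c [_ aV' _ ht]]] :=
  additive_on_normalize (polycyclic_subgroup pV) aV Vt lt.
by exists mu.
Qed.

Lemma finite_group_exponent V : subgroup V -> finite_index V [set 1] ->
  exists2 n, (0 < n)%N & forall x, V x -> x ^+ n = 1.
Proof.
move=> sV [s hs].
have Vs x : V x -> x \in s.
  by move=> /hs[y ys /(congr1 (fun z => y * z))]; rewrite mulVKg mulg1 => ->.
exists (size s)`!; first exact: fact_gt0.
move=> x Vx.
have : ~~ uniq (mkseq (fun i => x ^+ i) (size s).+1).
  apply/negP => /(@uniq_leq_size _ _ s); rewrite size_mkseq ltnn => h.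
  suff : false by [].
  by apply: h => _ /mapP[i _ ->]; apply: Vs; exact: subgroupX.
move=> /(uniqPn 1)[i [j [lt_ij]]]; rewrite size_mkseq => lt_j.
rewrite !nth_mkseq //; last exact: ltn_trans lt_j.
move=> e; have xji : x ^+ (j - i) = 1 by rewrite expgnFr 1?ltnW // e mulgV.
have /dvdnP[d ->] : (j - i %| (size s)`!)%N.
  by apply: dvdn_fact; rewrite subn_gt0 lt_ij (leq_trans (leq_subr _ _)).
by rewrite mulnC expgnA xji expg1n.
Qed.

(** Every integral character kills the torsion elements, so these lie in successive kernels, down to
    Hirsch length 0, where the subgroup is finite. *)
Lemma polycyclic_torsion V k : nilpotent_group G -> polycyclic V k ->
  subgroup (torsion G `&` V) /\ finite_index (torsion G `&` V) [set 1].
Proof.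
move=> nilG; elim: k V => [|k IH] V pV.
  have sV := polycyclic_subgroup pV; have finV := polycyclic0_finite pV.
  rewrite setIidr //; have [n n0 hn] := finite_group_exponent sV finV.
  by move=> x /hn xn; exists n.
have sV := polycyclic_subgroup pV.
have infV : ~ finite_index V [set 1] by move=> /(finite_group_polycyclic pV).
have [lam aV [t Vt lt]] := exists_character nilG pV infV.
have [k' [<-] pker] := polycyclic_kernel_on sV aV Vt lt pV.
suff -> : torsion G `&` V = torsion G `&` kernel_on V lam by exact: IH.
apply/seteqP; split=> x [tx]; last by case.
move=> Vx; split=> //; split=> //; case: tx => n n0 xn.
have := additive_on_zpow sV aV n%:Z Vx.
rewrite zpow_nat xn (additive_on1 sV aV) => /esym/eqP.
by rewrite mulf_eq0 => /orP[|/eqP //]; rewrite eqz_nat; case: n n0 {xn}.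
Qed.

End IntegerCharacters.

(** * Finitely generated nilpotent groups are polycyclic *)

Section LowerCentralSeries.
Local Open Scope group_scope.
Variable G : groupType.
Implicit Types (S K M : set G) (x y z : G).
Local Notation LCS := (lower_central_series G).

Lemma lower_central_subgroup i : subgroup (LCS i).
Proof. by case: i => [|i]; [exact: subgroup_setT|exact: subgroup_generated]. Qed.

Lemma lower_central_comm i x y : LCS i x -> LCS i.+1 [~ x, y].
Proof. by move=> Lx; apply: sub_generated; exists x, y. Qed.

Lemma lower_central_normal_sub i :
  (forall x y, LCS i x -> LCS i (x ^ y)) /\ LCS i.+1 `<=` LCS i.
Proof.
elim: i => [|i [nL sL]]; first by [].
have nL' x y : LCS i.+1 x -> LCS i.+1 (x ^ y).
  move=> Lx; rewrite -(mulVKg x (x ^ y)) -commgEl.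
  apply: (subgroupM (lower_central_subgroup _)) => //.
  by apply: lower_central_comm; apply: sL.
split=> //; apply: generated_min; first exact: lower_central_subgroup.
move=> _ [x [y [Lx ->]]]; rewrite commgEl.
apply: (subgroupM (lower_central_subgroup _)); last exact: nL'.
exact: (subgroupV (lower_central_subgroup _)).
Qed.

Lemma lower_central_normal i x y : LCS i x -> LCS i (x ^ y).
Proof. by case: (lower_central_normal_sub i) => + _; apply. Qed.

Lemma lower_central_sub i : LCS i.+1 `<=` LCS i.
Proof. by case: (lower_central_normal_sub i). Qed.

Lemma commMgR x y z : [~ x * y, z] = [~ x, z] * [~ [~ x, z], y] * [~ y, z].
Proof. by rewrite !commgEl !conjgE !gnorm. Qed.

Lemma commgMR x y z : [~ x, y * z] = [~ x, z] * ([~ x, y] * [~ [~ x, y], z]).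
Proof. by rewrite !commgEl !conjgE !gnorm. Qed.

Lemma commVgR x y : [~ x^-1, y] = [~ x, y]^-1 * [~ [~ x, y]^-1, x^-1].
Proof. by rewrite !commgEl !conjgE !gnorm. Qed.

Lemma commgVR x y : [~ x, y^-1] = [~ x, y]^-1 * [~ [~ x, y]^-1, y^-1].
Proof. by rewrite !commgEl !conjgE !gnorm. Qed.

(** Modulo the term after next, the commutator of an element of [LCS i] with an element of the group
    is multiplicative in both arguments, so commutators of generators suffice. *)
Lemma lower_central_generators S : finite_set S ->
  generated_subgroup S = [set: G] -> forall i, exists2 s : seq G,
    {in s, forall x, LCS i x} &
    LCS i `<=` generated_subgroup ([set` s] `|` LCS i.+1).
Proof.
move=> /finite_seqP[r ->{S}] genS; elim=> [|i [s hs genL]].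
  exists r => // x _; have : generated_subgroup [set` r] x by rewrite genS.
  apply: generated_min; first exact: subgroup_generated.
  by move=> y ry; apply: sub_generated; left.
exists [seq [~ a, b] | a <- s, b <- r].
  by move=> _ /allpairsP[[a b] [/hs La _ ->]]; exact: lower_central_comm.
set W := generated_subgroup _.
have sW : subgroup W by exact: subgroup_generated.
have LW : LCS i.+2 `<=` W by move=> x Lx; apply: sub_generated; right.
have cW z y : LCS i.+1 z -> W [~ z, y].
  by move=> Lz; apply: LW; exact: lower_central_comm.
have cV z y : LCS i.+1 z -> W [~ z^-1, y].
  by move=> Lz; apply: cW; apply: subgroupV Lz; exact: lower_central_subgroup.
have sL := lower_central_subgroup i.
have Wr b : b \in r -> forall x, LCS i x -> W [~ x, b].
  move=> rb; suff : LCS i `<=` LCS i `&` [set x | W [~ x, b]] by move=> h x /h[].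
  have sX : subgroup (LCS i `&` [set x | W [~ x, b]]).
    split=> [|x y [Lx Wx] [Ly Wy]].
      by split; [exact: subgroup1|rewrite /= comm1g; exact: subgroup1].
    split; first exact: sL.2.
    have Lx' := lower_central_comm b Lx; have Ly' := lower_central_comm b Ly.
    rewrite /= commMgR commVgR; do 2?apply: (subgroupM sW) => //.
    - exact: cW.
    - exact: (subgroupV sW).
    - exact: cV.
  apply: subset_trans genL _; apply: generated_min => // x [sx|Lx].
    split; first exact: hs.
    by apply: sub_generated; left; exact: (allpairs_f (fun a b => [~ a, b])).
  split; first exact: lower_central_sub.
  exact: cW.
apply: generated_min => // _ [x [y [Lx ->]]].
suff : generated_subgroup [set` r] `<=` [set y | forall x, LCS i x -> W [~ x, y]].
  by rewrite genS => /(_ y I); apply.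
apply: generated_min; last by move=> b rb x' Lx'; apply: Wr.
split=> [z _|a b Wa Wb z Lz]; first by rewrite commg1; exact: subgroup1.
have La := lower_central_comm a Lz; have Lb := lower_central_comm b Lz.
rewrite commgMR commgVR; do 2?apply: (subgroupM sW) => //.
- by apply: (subgroupV sW); exact: Wb.
- exact: cV.
- exact: Wa.
- exact: cW.
Qed.

(** Every subgroup between the two terms is normal in [LCS i], so adjoining the finitely many
    generators one at a time adds cyclic factors to the series. *)
Lemma polycyclic_lower_central S : finite_set S ->
  generated_subgroup S = [set: G] -> forall i k,
  polycyclic (LCS i.+1) k -> exists k', polycyclic (LCS i) k'.
Proof.
move=> finS genS i k pL.
have [s hs genL] := lower_central_generators finS genS i.
have sL := lower_central_subgroup i.
suff [M [k' [pM ML subM sM]]] : exists M k', [/\ polycyclic M k', M `<=` LCS i,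
    LCS i.+1 `<=` M & {in s, forall x, M x}].
  exists k'; suff <- : M = LCS i by [].
  apply/seteqP; split=> //; apply: subset_trans genL _.
  by apply: generated_min => [|x [/sM|/subM]//]; exact: polycyclic_subgroup pM.
elim: s hs {genL} => [|x s IH] hs.
  by exists (LCS i.+1), k; split=> //; exact: lower_central_sub.
have [|M [k' [pM ML subM sM]]] := IH.
  by move=> y ys; apply: hs; rewrite inE ys orbT.
have sgM := polycyclic_subgroup pM.
have Lx : LCS i x by apply: hs; rewrite mem_head.
have nM : normal_in M (LCS i).
  split=> // y z My Lz; rewrite -(mulVKg y (y ^ z)) -commgEl; apply: subgroupM => //.
  by apply: subM; apply: lower_central_comm; exact: ML.
pose K : set G := [set y | LCS i y /\ exists n, M (zpow x n * y)].
have sK : subgroup K.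
  split=> [|y z [Ly [n Mn]] [Lz [m Mm]]].
    split; first exact: subgroup1.
    by exists 0%R; rewrite zpow0 mulg1; exact: subgroup1.
  split; first exact: sL.2.
  exists (n - m)%R; apply: (zpow_cosetM nM Lx) => //.
  by apply: (zpow_cosetV nM Lx).
have MK : M `<=` K.
  by move=> y My; split; [exact: ML|exists 0%R; rewrite zpow0 mul1g].
have Kx : K x.
  split=> //; exists (-1)%R; rewrite zpowN zpow1 mulVg; exact: subgroup1.
have nMK : normal_in M K.
  by split=> // y z My [Lz _]; case: nM => _ _ _; apply.
have cK : cyclic_quotient K M.
  by apply/cyclic_quotientP => //; exists x => // y [].
exists K, (`[< ~ finite_index K M >] + k')%N; split; first exact: polycyclicS.
- by move=> y [].
- exact: subset_trans MK.
- by move=> y; rewrite inE => /orP[/eqP->//|/sM/MK].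
Qed.

Lemma nilpotent_polycyclic S : finite_set S ->
  generated_subgroup S = [set: G] -> nilpotent_group G ->
  exists k, polycyclic [set: G] k.
Proof.
move=> finS genS [c nil].
suff : forall j, exists k, polycyclic (LCS (c - j)) k by move=> /(_ c); rewrite subnn.
elim=> [|j [k pk]]; first by rewrite subn0 nil; exists 0%N; exact: polycyclic1.
have [le_cj|lt_jc] := leqP c j.
  by move: pk; rewrite (eqP (leqW le_cj : c - j.+1 == 0)%N) (eqP le_cj); exists k.
apply: (polycyclic_lower_central finS genS) (k) _.
by rewrite subnSK.
Qed.

End LowerCentralSeries.

(** * Images and preimages under surjective homomorphisms, and the quotient map *)

Section Epimorphism.
Local Open Scope group_scope.
Variables (G H : groupType) (p : G -> H).
Hypotheses (pM : forall x y, p (x * y) = p x * p y).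
Hypotheses (pS : forall y, exists x, p x = y).
Implicit Types (K M : set G) (L : set H) (x y z : G).

Lemma epi1 : p 1 = 1.
Proof. by apply: (@mulgI _ (p 1)); rewrite -pM !mulg1. Qed.

Lemma epiV x : p x^-1 = (p x)^-1.
Proof. by apply/esym/mulg1_eq; rewrite -pM mulgV epi1. Qed.

Lemma epi_zpow x n : p (zpow x n) = zpow (p x) n.
Proof.
have pos (k : nat) : p (x ^+ k) = p x ^+ k.
  by elim: k => [|k IH]; rewrite ?epi1 // !expgS pM IH.
by case: n => k /=; rewrite ?epiV pos.
Qed.

Lemma epiX x (n : nat) : p (x ^+ n) = p x ^+ n.
Proof. exact: (epi_zpow x n%:Z). Qed.

Lemma epiJ x y : p (x ^ y) = p x ^ p y.
Proof. by rewrite !conjgE !pM epiV. Qed.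

Lemma epiR x y : p [~ x, y] = [~ p x, p y].
Proof. by rewrite !commgEl pM epiV epiJ. Qed.

Lemma subgroup_image K : subgroup K -> subgroup (p @` K).
Proof.
move=> sK; split; first by exists 1; [exact: subgroup1|exact: epi1].
move=> _ _ [x Kx <-] [y Ky <-]; exists (x / y); first exact: sK.2.
by rewrite pM epiV.
Qed.

Lemma subgroup_preimage L : subgroup L -> subgroup (p @^-1` L).
Proof.
move=> sL; split; first by rewrite /preimage /= epi1; exact: subgroup1.
by move=> x y Lx Ly; rewrite /preimage /= pM epiV; exact: sL.2.
Qed.

Lemma lower_central_image i :
  lower_central_series H i `<=` p @` lower_central_series G i.
Proof.
elim: i => [y _|i IH]; first by have [x <-] := pS y; exists x.
apply: generated_min; first by apply: subgroup_image; exact: lower_central_subgroup.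
move=> _ [_ [v [/IH[x Lx <-] ->]]]; have [y <-] := pS v.
by exists [~ x, y]; [exact: lower_central_comm|rewrite epiR].
Qed.

Lemma nilpotent_image : nilpotent_group G -> nilpotent_group H.
Proof.
move=> [c nil]; exists c; apply/seteqP; split.
  by move=> y /lower_central_image; rewrite nil => -[x -> <-]; exact: epi1.
by move=> y ->; apply: subgroup1; exact: lower_central_subgroup.
Qed.

Lemma normal_in_image M K : normal_in M K -> normal_in (p @` M) (p @` K).
Proof.
move=> [sM sK MK nM]; split; do ?exact: subgroup_image.
  by move=> _ [x /MK Kx <-]; exists x.
by move=> _ _ [x Mx <-] [y Ky <-]; exists (x ^ y); [exact: nM|rewrite epiJ].
Qed.

Lemma polycyclic_image K k : polycyclic K k -> exists k', polycyclic (p @` K) k'.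
Proof.
elim=> [|M {}K {}k _ [k' pk'] nM cM].
  by exists 0%N; rewrite image_set1 epi1; exact: polycyclic1.
have [sM _ _ _] := nM.
eexists; apply: polycyclicS pk' (normal_in_image nM) _.
apply/cyclic_quotientP; first exact: subgroup_image.
have /(cyclic_quotientP _ sM)[x Kx hx] := cM.
exists (p x); first by exists x.
move=> _ [y Ky <-]; have [n Mn] := hx y Ky; exists n.
by exists (zpow x n * y) => //; rewrite pM epi_zpow.
Qed.

Lemma finite_index_preimage (L1 L2 : set H) :
  finite_index (p @^-1` L1) (p @^-1` L2) <-> finite_index L1 L2.
Proof.
split=> -[s hs].
  exists [seq p x | x <- s] => v; have [x <-] := pS v => /hs[y ys].
  by rewrite /preimage /= pM epiV => Ly; exists (p y) => //; exact: map_f.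
have /choice[f hf] := pS.
exists [seq f v | v <- s] => x /hs[v vs Lv]; exists (f v); first exact: map_f.
by rewrite /preimage /= pM epiV hf.
Qed.

(** A series of the kernel is continued by the preimages of a series of [L], which have the same
    factors: Hirsch length is additive in extensions. *)
Lemma polycyclic_preimage L a b : polycyclic (p @^-1` [set 1]) a ->
  polycyclic L b -> polycyclic (p @^-1` L) (a + b).
Proof.
move=> pa; elim=> [|M K k _ IH nM cM]; first by rewrite addn0.
have [sM sK MK nMK] := nM.
have -> : `[< ~ finite_index K M >] =
    `[< ~ finite_index (p @^-1` K) (p @^-1` M) >].
  by congr asbool; rewrite propeqE finite_index_preimage.
rewrite addnCA; apply: polycyclicS IH _ _.
  split; do ?exact: subgroup_preimage.
    by move=> x /MK.
  by move=> x y Mx Ky; rewrite /preimage /= epiJ; exact: nMK.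
apply/cyclic_quotientP; first exact: subgroup_preimage.
have /(cyclic_quotientP _ sM)[v Kv hv] := cM.
have [x xv] := pS v; exists x; first by rewrite /preimage /= xv.
move=> y Ky; have [n Mn] := hv _ Ky; exists n.
by rewrite /preimage /= pM epi_zpow xv.
Qed.

End Epimorphism.

Section QuotientMap.
Local Open Scope group_scope.
Local Open Scope quotient_scope.
Variables (G : groupType) (N : set G).
Hypothesis nN : normal_in N [set: G].

Definition quotient_map (x : G) : quotient_group N := \pi_(quotient_group N) x.

Lemma quotient_mapM x y : quotient_map (x * y) = quotient_map x * quotient_map y.
Proof. exact: quotient_piM. Qed.

Lemma quotient_map_surj y : exists x, quotient_map x = y.
Proof. by exists (repr y); exact: reprK. Qed.

Lemma quotient_map_eq1 x : quotient_map x = 1 <-> N x.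
Proof. by have := quotient_pi_eq1 N x; rewrite (normal_closure_id nN). Qed.

End QuotientMap.

(** * Polynomial functions on a nilpotent group *)

Section PolynomialFunctions.
Local Open Scope group_scope.
Variable G : groupType.
Implicit Types (M V N : set G) (x y z g : G) (f : G -> int).

Definition fdiff g f : G -> int := fun x => (f (x * g)%g - f x)%R.

(** The degree is less than [k]: 0 is left for the zero function, and a character has [k = 2]. *)
Fixpoint poly_on V (k : nat) f : Prop :=
  if k is k'.+1 then forall g, V g -> poly_on V k' (fdiff g f)
  else forall x, V x -> f x = 0%R.

Lemma poly_on_ext V k f f' : subgroup V -> (forall x, V x -> f x = f' x) ->
  poly_on V k f -> poly_on V k f'.
Proof.
move=> sV; elim: k f f' => [|k IH] f f' eqf pf.
  by move=> x Vx; rewrite -eqf // pf.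
move=> g Vg; apply: (IH (fdiff g f)) (pf g Vg) => x Vx.
by rewrite /fdiff !eqf //; exact: subgroupM.
Qed.

Lemma poly_on_additive V lam : subgroup V -> additive_on V lam -> poly_on V 2 lam.
Proof.
move=> sV aV g Vg h Vh x Vx; rewrite /fdiff !aV //; do ?exact: subgroupM.
by ring.
Qed.

Section Filtered.
Variable M : set G.

(* [weighted_poly k] means degree < k.  The series being indexed from 0, an
   element of [lower_central_series G w] has weight w + 1: it takes degree < k + 1
   to degree < k - w. *)
Inductive weighted_poly : nat -> (G -> int) -> Prop :=
| weighted_poly0 f : (forall x, M x -> f x = 0%R) -> weighted_poly 0 f
| weighted_polyS k f : (forall w g, M g -> lower_central_series G w g ->
    weighted_poly (k - w) (fdiff g f)) -> weighted_poly k.+1 f.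

Hypothesis sM : subgroup M.

Lemma weighted_poly0E f : weighted_poly 0 f -> forall x, M x -> f x = 0%R.
Proof. by move=> pf; inversion pf. Qed.

Lemma weighted_polySE k f : weighted_poly k.+1 f ->
  forall w g, M g -> lower_central_series G w g ->
    weighted_poly (k - w) (fdiff g f).
Proof. by move=> pf; inversion pf. Qed.

Lemma weighted_poly_zero k f : (forall x, M x -> f x = 0%R) -> weighted_poly k f.
Proof.
elim/ltn_ind: k f => -[|k] IH f f0; first exact: weighted_poly0.
apply: weighted_polyS => w g Mg _; apply: IH; first by rewrite ltnS leq_subr.
by move=> x Mx; rewrite /fdiff !f0 ?subrr //; exact: subgroupM.
Qed.

Lemma weighted_poly_ext k f f' : (forall x, M x -> f x = f' x) ->
  weighted_poly k f -> weighted_poly k f'.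
Proof.
move=> + pf; elim: pf f' => {k f} [f f0|k f _ IH] f' eqf.
  by apply: weighted_poly0 => x Mx; rewrite -eqf ?f0.
apply: weighted_polyS => w g Mg Lg; apply: (IH w g) => // x Mx.
by rewrite /fdiff !eqf //; exact: subgroupM.
Qed.

Lemma weighted_poly_leq k k' f : (k <= k')%N ->
  weighted_poly k f -> weighted_poly k' f.
Proof.
move=> + pf; elim: pf k' => {k f} [f f0|k f _ IH] k'.
  by move=> _; exact: weighted_poly_zero.
case: k' => // k' le_kk'; apply: weighted_polyS => w g Mg Lg.
by apply: (IH w g) => //; apply: leq_sub2r.
Qed.

Lemma weighted_polyD k f f' : weighted_poly k f -> weighted_poly k f' ->
  weighted_poly k (fun x => f x + f' x)%R.
Proof.
elim/ltn_ind: k f f' => -[|k] IH f f' pf pf'.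
  by apply: weighted_poly0 => x Mx; rewrite !weighted_poly0E ?addr0.
apply: weighted_polyS => w g Mg Lg.
apply: (weighted_poly_ext (f := fun x => (fdiff g f x + fdiff g f' x)%R)).
  by move=> x _; rewrite /fdiff; ring.
apply: IH; first by rewrite ltnS leq_subr.
  exact: (weighted_polySE pf).
exact: (weighted_polySE pf').
Qed.

Lemma weighted_poly_diff k f g : M g -> weighted_poly k f ->
  weighted_poly k.-1 (fdiff g f).
Proof.
case: k => [|k] Mg pf; last by rewrite -[k]subn0; apply: (weighted_polySE pf).
apply: weighted_poly0 => x Mx; rewrite /fdiff !(weighted_poly0E pf) ?subrr //.
exact: subgroupM.
Qed.

Lemma weighted_poly_shift k f g : M g -> weighted_poly k f ->
  weighted_poly k (fun x => f (x * g)).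
Proof.
move=> Mg pf; apply: (weighted_poly_ext (f := fun x => (f x + fdiff g f x)%R)).
  by move=> x _; rewrite /fdiff addrC subrK.
apply: weighted_polyD => //; apply: weighted_poly_leq (leq_pred k) _.
exact: weighted_poly_diff.
Qed.

Variable y : G.
Hypothesis My : forall x, M x -> M (x ^ y).

Lemma weighted_poly_conj k f : weighted_poly k f ->
  weighted_poly k (fun x => f (x ^ y)).
Proof.
elim/ltn_ind: k f => -[|k] IH f pf.
  by apply: weighted_poly0 => x Mx; rewrite (weighted_poly0E pf) //; exact: My.
apply: weighted_polyS => w g Mg Lg.
apply: (weighted_poly_ext (f := fun x => fdiff (g ^ y) f (x ^ y))).
  by move=> x _; rewrite /fdiff conjMg.
apply: IH; first by rewrite ltnS leq_subr.
apply: (weighted_polySE pf); first exact: My.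
exact: lower_central_normal.
Qed.

(* Since g ^ y = g * [~ g, y] and [~ g, y] is one step further in the filtration,
   conjugation by [y] acts unipotently for the weighted degree. *)
Lemma weighted_poly_conj_diff k f : weighted_poly k f ->
  weighted_poly k.-1 (fun x => f (x ^ y)%g - f x)%R.
Proof.
elim/ltn_ind: k f => -[|[|k]] IH f pf.
- apply: weighted_poly0 => x Mx.
  by rewrite !(weighted_poly0E pf) ?subrr //; exact: My.
- apply: weighted_poly0 => x Mx.
  have Mxy : M [~ x, y].
    by rewrite commgEl; apply: (subgroupM sM); [exact: (subgroupV sM)|exact: My].
  have := weighted_poly0E (weighted_polySE pf (w := 0) Mxy I) Mx.
  by rewrite /fdiff commgEl mulKVg.
apply: weighted_polyS => w g Mg Lg.
have Mu : M [~ g, y].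
  by rewrite commgEl; apply: (subgroupM sM); [exact: (subgroupV sM)|exact: My].
have Lu := lower_central_comm y Lg.
pose u := [~ g, y].
(* The difference along [g] of f(x^y) - f(x) is the same expression formed from [fdiff g f], plus a
   difference along [u], which lies one step deeper in the filtration and so lowers the degree once
   more. *)
apply: (weighted_poly_ext (f := fun x =>
    ((fdiff g f (x ^ y)%g - fdiff g f x) + fdiff u f (x ^ y * g)%g)%R)).
  move=> x _; rewrite /fdiff conjMg -(mulgA _ g u) (_ : g * u = g ^ y); first by ring.
  by rewrite /u commgEl mulKVg.
apply: weighted_polyD.
  have := IH _ _ _ (weighted_polySE pf Mg Lg).
  rewrite subSKn => h.
  case: (leqP w k) => [le_wk|lt_kw].
    by move: h; rewrite (subSn le_wk) /=; apply; rewrite ltnS -(subSn le_wk) leq_subr.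
  have /eqP e : (k - w == 0)%N by rewrite subn_eq0 ltnW.
  have /eqP e' : (k.+1 - w == 0)%N by rewrite subn_eq0.
  by move: h; rewrite e e' /=; apply.
have pu := weighted_polySE pf Mu Lu.
rewrite subSS in pu.
exact: (weighted_poly_conj (weighted_poly_shift Mg pu)).
Qed.

End Filtered.

Lemma lower_central_leq (i j : nat) : (i <= j)%N ->
  lower_central_series G j `<=` lower_central_series G i.
Proof.
elim: j => [|j IH]; first by rewrite leqn0 => /eqP->.
rewrite leq_eqVlt => /orP[/eqP->//|]; rewrite ltnS => /IH.
exact: subset_trans (@lower_central_sub _ _).
Qed.

(** Nontrivial elements have weight at most [c], so an allowance of c + 1 for each ordinary
    difference covers them all. *)
Lemma poly_on_weighted M c k f : subgroup M ->
  lower_central_series G c = [set 1] ->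
  poly_on M k f -> weighted_poly M (c.+1 * k)%N f.
Proof.
move=> sM nil; elim: k f => [|k IH] f pf.
  by rewrite muln0; apply: weighted_poly0.
rewrite mulnS addSn; apply: weighted_polyS => w g Mg Lg.
have [le_wc|lt_cw] := leqP w c.
  by apply: (weighted_poly_leq sM) (IH _ (pf g Mg)) => //; rewrite -addnBAC // leq_addl.
have := lower_central_leq (ltnW lt_cw) Lg; rewrite nil => ->.
by apply: (weighted_poly_zero sM) => x _; rewrite /fdiff mulg1 subrr.
Qed.

Section Extension.
Variables (V : set G) (lam : G -> int) (t : G).
Hypotheses (sV : subgroup V) (aV : additive_on V lam) (Vt : V t) (lt : lam t = 1%R).
Let M := kernel_on V lam.

(** Composition of [f] with the retraction of [V] onto the kernel along powers of [t]. The
    retraction is not a homomorphism in general, so a lifted character is only polynomial. *)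
Definition lift_kernel f x := f (zpow t (- lam x)%R * x).

Lemma kernel_on_lift x : V x -> M (zpow t (- lam x)%R * x).
Proof.
move=> Vx; have Vz := subgroup_zpow (- lam x)%R sV Vt; split.
  exact: subgroupM.
by rewrite aV // (additive_on_zpow sV aV) // lt mulr1 addNr.
Qed.

Lemma lift_kernelE f x : M x -> lift_kernel f x = f x.
Proof. by move=> [_ lx]; rewrite /lift_kernel lx oppr0 zpow0 mul1g. Qed.

Lemma weighted_poly_lift k f : weighted_poly M k f -> poly_on V k (lift_kernel f).
Proof.
have nM : normal_in M V by exact: normal_in_kernel_on.
have [sM _ _ nMV] := nM.
elim: k f => [|k IH] f pf.
  by move=> x Vx; apply: (weighted_poly0E pf); exact: kernel_on_lift.
move=> g Vg; set n := zpow t (- lam g)%R * g.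
have Mn : M n by exact: kernel_on_lift.
pose y := zpow t (lam g).
have Vy : V y by exact: subgroup_zpow.
have MyM x : M x -> M (x ^ y) by move=> Mx; exact: nMV.
(* If x retracts to m, then x g retracts to m^y n. Hence the difference of the lift along [g] is the
   lift of [h], and both summands of [h] have lower weighted degree. *)
pose h x := (fdiff n f (x ^ y) + (f (x ^ y)%g - f x))%R.
apply: (poly_on_ext (f := lift_kernel h)) => // [x Vx|].
  rewrite /lift_kernel /h /fdiff aV // addrA subrK; congr (f _ - _)%R.
  rewrite conjgE /y /n opprD (addrC (- lam x)%R) (zpowD t (- lam g)) !zpowN !mulgA.
  by rewrite mulgK.
apply: IH; apply: (weighted_polyD sM).
  apply: (weighted_poly_conj sM MyM (k := k)).
  exact: (weighted_poly_diff sM Mn pf).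
exact: (weighted_poly_conj_diff sM MyM pf).
Qed.

Lemma poly_on_extend k f : nilpotent_group G -> poly_on M k f ->
  exists k' F, poly_on V k' F /\ forall x, M x -> F x = f x.
Proof.
move=> [c nil] pf; exists (c.+1 * k)%N, (lift_kernel f); split.
  apply: weighted_poly_lift; apply: poly_on_weighted => //.
  by case: (normal_in_kernel_on sV aV).
exact: lift_kernelE.
Qed.

End Extension.

(** Appending a letter changes [f] by a difference of lower degree; summing along the word raises
    the exponent by one. *)
Lemma poly_on_bound (s : seq G) k f : poly_on [set: G] k f ->
  exists C : nat, forall w : seq G, {subset w <= s} ->
    (`|f (\prod_(a <- w) a)%g| <= C * (size w).+1 ^ k)%N.
Proof.
elim: k f => [|k IH] f pf.
  by exists 0%N => w _; rewrite pf.
have bound_seq (r : seq G) : exists C : nat, forall a, a \in r ->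
    forall w : seq G, {subset w <= s} ->
    (`|fdiff a f (\prod_(a <- w) a)%g| <= C * (size w).+1 ^ k)%N.
  elim: r => [|a r [C hC]]; first by exists 0%N.
  have [D hD] := IH _ (pf a I).
  exists (C + D)%N => b; rewrite inE => /orP[/eqP->|rb] w ws; rewrite mulnDl.
    exact: leq_trans (hD w ws) (leq_addl _ _).
  exact: leq_trans (hC b rb w ws) (leq_addr _ _).
have [C hC] := bound_seq s.
exists (`|f 1%g| + C)%N => w; elim/last_ind: w => [|w a IHw] ws.
  by rewrite big_nil exp1n muln1 leq_addr.
have wws : {subset w <= s} by move=> b wb; apply: ws; rewrite mem_rcons inE wb orbT.
have sa : a \in s by apply: ws; rewrite mem_rcons mem_head.
have {}IHw := IHw wws; have := hC a sa w wws.
rewrite -cats1 big_cat big_seq1 /= cats1 size_rcons /fdiff.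
set P := \prod_(b <- w) b; set n := (size w).+1 => hd.
have le1 : (`|f (P * a)%g| <= `|f P| + `|(f (P * a)%g - f P)%R|)%N by lia.
apply: leq_trans le1 _; apply: leq_trans (leq_add IHw hd) _.
rewrite !expnS.
have le2 : (n ^ k <= n.+1 ^ k)%N by case: (k) => // k'; rewrite leq_exp2r.
have : (n * n ^ k + n ^ k <= n.+1 * n.+1 ^ k)%N.
  by rewrite addnC -mulSn leq_mul2l le2 orbT.
set u := (n * n ^ k)%N; set v := (n.+1 * _)%N; set z := (n ^ k)%N => le3.
apply: leq_trans (leq_mul (leqnn _) le3).
by rewrite mulnDr leq_add2l leq_mul2r leq_addl orbT.
Qed.

(** Newton's forward difference formula, [a i] being the i-th difference of [a 0]. *)
Lemma newton_expansion k (a : nat -> (nat -> int)) :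
  (forall i n, a i.+1 n = a i n.+1 - a i n)%R -> (forall n, a k n = 0%R) ->
  forall n, a 0%N n = (\sum_(i < k) 'C(n, i)%:Z * a i 0%N)%R.
Proof.
move=> aS; elim: k a aS => [|k IH] a aS ak n; first by rewrite big_ord0 ak.
elim: n => [|n IHn].
  rewrite big_ord_recl bin0 mul1r big1 ?addr0 // => i _.
  by rewrite bin0n mul0r.
have {}IH := IH (fun i => a i.+1) (fun i n => aS i.+1 n) ak n.
have -> : a 0%N n.+1 = (a 1%N n + a 0%N n)%R by rewrite aS subrK.
rewrite IH IHn big_ord_recl [in RHS]big_ord_recl !bin0 !mul1r addrCA.
congr (_ + _)%R; rewrite -big_split /=; apply: eq_bigr => i _.
by rewrite binS PoszD mulrDl addrC.
Qed.

(** In i C(n, i) = n C(n - 1, i - 1) with n = k! d, the factor i is absorbed by k! and d remains.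
    Hence the period k! d of a polynomial modulo d. *)
Lemma dvdn_bin_fact k d i : (0 < i <= k)%N -> (d %| 'C(k`! * d, i))%N.
Proof.
case: i => // i /= le_ik.
have [->|d0] := posnP d; first by rewrite muln0 bin0n.
have /dvdnP[q e] : (i.+1 %| k`!)%N by apply: dvdn_fact.
have := mul_bin_diag (k`! * d)%N i; rewrite {1}e => /eqP.
rewrite (mulnC q) -!mulnA eqn_pmul2l // => /eqP <-.
by rewrite dvdn_mull // dvdn_mulr.
Qed.

Lemma poly_on_periodic k f x g d : poly_on [set: G] k f ->
  (d%:Z %| (f (x * g ^+ (k`! * d))%g - f x)%R)%Z.
Proof.
move=> pf; pose a i n := iter i (fdiff g) f (x * g ^+ n).
have aS i n : (a i.+1 n = a i n.+1 - a i n)%R.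
  by rewrite /a iterS {1}/fdiff expgSr mulgA.
have ak n : a k n = 0%R.
  rewrite /a; move: (x * g ^+ n) => z.
  elim: k f pf {a aS} z => [|k IH] f pf z; first by apply: pf.
  by rewrite iterSr; apply: IH; apply: pf.
have := newton_expansion aS ak (k`! * d)%N.
rewrite {1}/a /= => ->.
case: k ak pf aS => [|k] ak pf aS.
  by rewrite big_ord0 pf // subrr dvdz0.
rewrite big_ord_recl bin0 mul1r {1}/a /= expg0 mulg1 addrC addKr.
apply: rpred_sum => i _.
apply: dvdz_mulr; rewrite dvdzE /=; apply: dvdn_bin_fact.
by rewrite /= (leq_trans (ltn_ord i)).
Qed.

(** Factors are allowed on both sides of the period so that the subgroup is normal. *)
Definition congruence_kernel f (d : nat) : set G :=
  [set g | forall x y, (d%:Z %| (f (x * g * y)%g - f (x * y)%g)%R)%Z].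

Lemma normal_congruence_kernel f d : normal_in (congruence_kernel f d) [set: G].
Proof.
split=> //.
  split=> [x y|g h Ng Nh x y]; first by rewrite mulg1 subrr dvdz0.
  have := Nh (x * g / h) y; rewrite mulgVK => h1.
  have := Ng x y => h2.
  have -> : (f (x * (g / h) * y)%g - f (x * y)%g =
    (f (x * g * y)%g - f (x * y)%g) -
    (f (x * g * y)%g - f (x * g / h * y)%g))%R by rewrite !mulgA; ring.
  exact: rpredB.
move=> g h Ng _ x y; have := Ng (x * h^-1) (h * y).
by rewrite conjgE !mulgA mulgVK.
Qed.

Lemma congruence_kernelX k f d g : poly_on [set: G] k f ->
  congruence_kernel f d (g ^+ (k`! * d)).
Proof.
move=> pf x y; have -> : x * g ^+ (k`! * d) * y = x * y * (g ^ y) ^+ (k`! * d).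
  by rewrite -conjXg conjgE !mulgA mulgK.
exact: poly_on_periodic.
Qed.

(** An infinite cyclic factor contributes at most [E] cosets, because the E-th power of its
    generator lies in [N]; a finite factor contributes a constant independent of [N] and [E]. *)
Lemma index_exponent_bound K k : polycyclic K k -> exists C : nat,
  forall N E, normal_in N [set: G] -> (0 < E)%N ->
    (forall x, K x -> N (x ^+ E)) ->
    exists2 s : seq G, (size s <= C * E ^ k)%N &
      forall x, K x -> exists2 y, y \in s & N (y^-1 * x).
Proof.
elim=> [|M {}K {}k _ [C hC] nM cM].
  exists 1%N => N E nN E0 _; exists [:: 1] => // x ->.
  by exists 1; rewrite ?inE // invg1 mulg1; apply: subgroup1; case: nN.
have [sM sK MK nMK] := nM.
case: asboolP => [_|/contrapT[r hr]].
  have /(cyclic_quotientP _ sM)[t Kt ht] := cM.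
  exists C => N E nN E0 NE; have [sN _ _ nNG] := nN.
  have [s sz_s hs] := hC N E nN E0 (fun x Mx => NE x (MK _ Mx)).
  exists [seq t ^+ j * y | j <- iota 0 E, y <- s].
    by rewrite size_allpairs size_iota expnS mulnCA leq_mul2l sz_s orbT.
  move=> x Kx; have [n Mn] := ht x Kx.
  have [y ys Ny] := hs _ Mn.
  have j_lt : (((- n)%R %% E%:Z)%Z < E%:Z)%R by apply: ltz_pmod; rewrite ltz_nat.
  have j_ge : (0 <= ((- n)%R %% E%:Z)%Z)%R by apply: modz_ge0; rewrite gt_eqF // ltz_nat.
  have e := divz_eq (- n)%R E%:Z.
  case: ((- n)%R %% E%:Z)%Z j_lt j_ge e => // j j_lt _ e.
  exists (t ^+ j * y); first by apply: allpairs_f => //; rewrite mem_iota.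
  set q := ((- n)%R %/ E%:Z)%Z in e.
  have Nq : N (zpow t (q * E%:Z)%R).
    by rewrite -zpow_expg; apply: subgroup_zpow => //; exact: NE.
  have -> : (t ^+ j * y)^-1 * x =
      zpow t (q * E%:Z)%R ^ (t ^+ j * y) * (y^-1 * (zpow t n * x)).
    have -> : zpow t n = (zpow t (q * E%:Z)%R * t ^+ j)^-1.
      by rewrite -zpow_nat -zpowD -e zpowN invgK.
    rewrite conjgE !invgM !mulgA; congr (_ * x).
    by rewrite !mulgK.
  by apply: subgroupM => //; apply: nNG.
exists (size r * C)%N => N E nN E0 NE; have [sN _ _ nNG] := nN.
have [s sz_s hs] := hC N E nN E0 (fun x Mx => NE x (MK _ Mx)).
exists [seq y * z | y <- r, z <- s].
  by rewrite size_allpairs -mulnA leq_mul2l sz_s orbT.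
move=> x /hr[y ry] /hs[z sz]; rewrite mulgA -invgM => Nz.
by exists (y * z) => //; exact: allpairs_f.
Qed.

End PolynomialFunctions.

(** * The general upper bound *)

Section SmallNondivisors.

(* Leibniz's harmonic triangle: 1 / (n.+1 * 'C(n, k)) is an integral combination
   of 1, 1/2, ..., 1/n.+1. *)
Lemma leibniz_dvdn a n k : (k <= n)%N ->
  (forall d, (0 < d <= n.+1)%N -> (d %| a)%N) -> (n.+1 * 'C(n, k) %| a)%N.
Proof.
elim: k n => [|k IH] n le_kn ha; first by rewrite bin0 muln1; apply: ha; rewrite leqnn.
case: n le_kn ha => // n; rewrite ltnS => le_kn ha.
set W := (n.+2 * 'C(n.+1, k.+1))%N.
set X := (n.+2 * 'C(n.+1, k))%N; set Y := (n.+1 * 'C(n, k))%N.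
have /dvdnP[q eq] : (X %| a)%N by apply: IH => //; rewrite leqW.
have /dvdnP[r er] : (Y %| a)%N.
  by apply: IH => // d /andP[d0 le_d]; apply: ha; rewrite d0 leqW.
have X0 : (0 < X)%N by rewrite /X muln_gt0 bin_gt0 (leqW le_kn).
have Y0 : (0 < Y)%N by rewrite /Y muln_gt0 bin_gt0.
have eW : (k.+1 * W = n.+2 * Y)%N by rewrite /W mulnCA -mul_bin_diag.
have eX : ((n.+1 - k) * X = n.+2 * Y)%N by rewrite /X mulnCA -mul_bin_down.
have p0 : (0 < n.+1 - k)%N by rewrite subn_gt0 ltnS.
have em : (n.+2 = (n.+1 - k) + k.+1)%N by lia.
have eWX : (W * X = W * Y + X * Y)%N.
  apply/eqP; rewrite -(@eqn_pmul2l ((n.+1 - k) * k.+1)%N) ?muln_gt0 ?p0 //.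
  have -> : ((n.+1 - k) * k.+1 * (W * X) = (k.+1 * W) * ((n.+1 - k) * X))%N by ring.
  have -> : ((n.+1 - k) * k.+1 * (W * Y + X * Y) =
    (n.+1 - k) * Y * (k.+1 * W) + k.+1 * Y * ((n.+1 - k) * X))%N by ring.
  rewrite eW eX -mulnDl -mulnDl -em; apply/eqP; ring.
have e : (a + q * W = r * W)%N.
  have XY0 : (0 < X * Y)%N by rewrite muln_gt0 X0 Y0.
  apply/eqP; rewrite -(eqn_pmul2l XY0); apply/eqP.
  have -> : (X * Y * (a + q * W) = a * (X * Y) + (q * X) * (W * Y))%N by ring.
  have -> : (X * Y * (r * W) = (r * Y) * (W * X))%N by ring.
  by rewrite -eq -er eWX; ring.
by rewrite -(dvdn_addl a (dvdn_mull q (dvdnn W))) e dvdn_mull.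
Qed.

(** All n + 1 numbers (n + 1) C(n, k) divide [a], hence are at most [a]; their sum is (n + 1)
    2^n. *)
Lemma common_multiple_lower_bound a n : (0 < a)%N ->
  (forall d, (0 < d <= n.+1)%N -> (d %| a)%N) -> (2 ^ n <= a)%N.
Proof.
move=> a0 ha; rewrite -(@leq_pmul2l n.+1) //.
have -> : (2 ^ n = \sum_(k < n.+1) 'C(n, k))%N.
  by rewrite -[2%N]/(1 + 1)%N expnDn; apply: eq_bigr => i _; rewrite !exp1n !muln1.
rewrite big_distrr /= -[X in (_ <= X * a)%N]card_ord -sum_nat_const.
apply: leq_sum => k _; apply: dvdn_leq => //; apply: leibniz_dvdn => //.
by rewrite -ltnS.
Qed.

Lemma small_nondivisor a A m n : (0 < a)%N -> (a <= A * n.+1 ^ m)%N ->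
  exists d, [/\ (0 < d)%N, ~~ (d %| a)%N &
    (d <= (A + m + 2) * (trunc_log 2 n.+1).+1)%N].
Proof.
move=> a0 aA.
have exP : exists d, (0 < d)%N && ~~ (d %| a)%N.
  by exists a.+1; rewrite /= gtnNdvd.
case: (ex_minnP exP) => d /andP[d0 dNa] minP; exists d; split=> //.
set l := trunc_log 2 n.+1.
have dvd_lt e : (0 < e < d)%N -> (e %| a)%N.
  by move=> /andP[e0 lt_ed]; apply: contraTT lt_ed => Ne; rewrite -leqNgt minP ?e0.
(* From here [d] is the least non-divisor minus 2: all of 1, ..., d + 1 divide [a], so 2^d is at
   most [a], which is polynomial in [n]. *)
case: d d0 dNa minP dvd_lt => [//|[|d]] _ dNa minP dvd_lt; first by rewrite dvd1n in dNa.
have le2 : (2 ^ d <= a)%N.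
  by apply: common_multiple_lower_bound => // e; rewrite -ltnS; exact: dvd_lt.
have ltA : (a < 2 ^ (A + m * l.+1))%N.
  apply: leq_ltn_trans aA _; rewrite expnD.
  have hA : (A < 2 ^ A)%N by exact: ltn_expl.
  have hn : (n.+1 ^ m <= 2 ^ (m * l.+1))%N.
    rewrite mulnC expnM; case: (m) => // m'; rewrite leq_exp2r //.
    by apply: ltnW; exact: trunc_log_ltn.
  apply: leq_ltn_trans (leq_mul (leqnn A) hn) _.
  by rewrite ltn_pmul2r // expn_gt0.
have : (d < A + m * l.+1)%N by rewrite -(@ltn_exp2l 2) //; exact: leq_ltn_trans ltA.
nia.
Qed.

End SmallNondivisors.

Section UpperBound.
Local Open Scope group_scope.
Variable G : groupType.
Implicit Types (M V N : set G) (x y z g : G) (f : G -> int).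

Definition index_le N (B : nat) :=
  exists2 s : seq G, (size s <= B)%N & forall x, exists2 y, y \in s & N (y^-1 * x).

Lemma index_leW N B B' : (B <= B')%N -> index_le N B -> index_le N B'.
Proof. by move=> le_BB' [r sz_r hr]; exists r => //; exact: leq_trans le_BB'. Qed.

(** Words over a fixed list take the place of word length, so that the property can be pulled back
    along a homomorphism letter by letter. Torsion elements are excluded because no integral
    character sees them. *)
Definition log_separated (s : seq G) V (h : nat) := exists C : nat,
  forall w : seq G, {subset w <= s} ->
    let x := \prod_(a <- w) a in V x -> ~ torsion G x ->
    exists N, [/\ normal_in N [set: G], ~ N x &
      index_le N (C * (trunc_log 2 (size w).+1).+1 ^ h)].

Lemma poly_on_separates (s : seq G) h m f : polycyclic [set: G] h ->
  poly_on [set: G] m f -> f 1 = 0%R -> exists C : nat,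
  forall w : seq G, {subset w <= s} ->
    let x := \prod_(a <- w) a in f x <> 0%R ->
    exists N, [/\ normal_in N [set: G], ~ N x &
      index_le N (C * (trunc_log 2 (size w).+1).+1 ^ h)].
Proof.
move=> pG pf f1; have [A hA] := poly_on_bound s pf.
have [C hC] := index_exponent_bound pG.
exists (C * (m`! * (A + m + 2)) ^ h)%N => w ws x fx.
have a0 : (0 < `|f x|)%N by rewrite absz_gt0; apply/eqP.
have [d [d0 dNa le_d]] := small_nondivisor a0 (hA w ws).
pose E := (m`! * d)%N.
have [|x' _|r sz_r hr] := hC _ E (normal_congruence_kernel f d).
- by rewrite muln_gt0 fact_gt0.
- exact: congruence_kernelX.
exists (congruence_kernel f d); split; first exact: normal_congruence_kernel.
  by move=> /(_ 1 1); rewrite !mulg1 mul1g f1 subr0 dvdzE /=; apply/negP.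
exists r => [|y]; last exact: hr.
apply: leq_trans sz_r _; rewrite -mulnA leq_mul2l -expnMn; apply/orP; right.
case: (h) => // h'; rewrite leq_exp2r // /E -mulnA leq_mul2l le_d orbT //.
Qed.

(** While [V] shrinks through kernels, the exponent [h] remains that of the whole group. The
    assumption that polynomials extend passes to the kernel by [poly_on_extend]; at Hirsch length 0
    only torsion is left. *)
Lemma log_separated_extendable (s : seq G) h V k : nilpotent_group G ->
  polycyclic [set: G] h -> polycyclic V k ->
  (forall m f, poly_on V m f ->
    exists m' F, poly_on [set: G] m' F /\ forall x, V x -> F x = f x) ->
  log_separated s V h.
Proof.
move=> nilG pG; elim: k V => [|k IH] V pV extV.
  exists 0%N => w ws x Vx ntx; case: ntx.
  have sV := polycyclic_subgroup pV.
  have [n n0 hn] := finite_group_exponent sV (polycyclic0_finite pV).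
  by exists n => //; apply: hn.
have sV := polycyclic_subgroup pV.
have infV : ~ finite_index V [set 1] by move=> /(finite_group_polycyclic pV).
have [lam aV [t Vt lt]] := exists_character nilG pV infV.
have [k' [<-] pker] := polycyclic_kernel_on sV aV Vt lt pV.
have [|C hC] := IH _ pker.
  move=> m f pf; have [m1 [F1 [pF1 eF1]]] := poly_on_extend sV aV Vt lt nilG pf.
  have [m2 [F2 [pF2 eF2]]] := extV _ _ pF1.
  exists m2, F2; split=> // x Mx; rewrite eF2 ?eF1 //; by case: Mx.
have [m [F [pF eF]]] := extV _ _ (poly_on_additive sV aV).
have F1 : F 1 = 0%R by rewrite eF ?(additive_on1 sV aV) //; exact: subgroup1.
have [D hD] := poly_on_separates s pG pF F1.
exists (C + D)%N => w ws x Vx ntx.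
have [lx|/eqP lx] := eqVneq (lam x) 0%R.
  have [N [nN Nx iN]] := hC w ws (conj Vx lx) ntx.
  by exists N; split=> //; apply: index_leW iN; rewrite leq_mul2r leq_addr orbT.
have [|N [nN Nx iN]] := hD w ws; first by rewrite eF.
by exists N; split=> //; apply: index_leW iN; rewrite leq_mul2r leq_addl orbT.
Qed.

Lemma log_separated_setT (s : seq G) h : nilpotent_group G ->
  polycyclic [set: G] h -> log_separated s [set: G] h.
Proof.
by move=> nilG pG; apply: (log_separated_extendable s nilG pG pG) => // m f pf; exists m, f.
Qed.

End UpperBound.

(** * The lower bound *)

Section CommonMultiples.

(** By Legendre's formula the exponent of [p] is the sum over k of floor(2n / p^k) - 2 floor(n /
    p^k). No term is negative, and the one at k = e is positive. *)
Lemma prime_dvd_central_bin p e n : prime p -> (n < p ^ e <= n.*2)%N ->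
  (p %| 'C(n.*2, n))%N.
Proof.
move=> pr_p /andP[lt_n le_2n].
have sub_n : (n.*2 - n = n)%N by rewrite -addnn addnK.
have bf := @bin_fact n.*2 n; rewrite sub_n in bf.
have {}bf := bf (leq_trans (leq_addr n n) (eq_leq (addnn n))).
have := congr1 (logn p) bf.
have C0 : (0 < 'C(n.*2, n))%N by rewrite bin_gt0 -addnn leq_addr.
rewrite lognM ?muln_gt0 ?fact_gt0 // lognM ?fact_gt0 // !logn_fact // => e_log.
rewrite -(expn1 p) pfactor_dvdn // -(ltn_add2r
  (\sum_(1 <= k < n.+1) n %/ p ^ k + \sum_(1 <= k < n.+1) n %/ p ^ k)%N).
rewrite e_log add0n -big_split /=.
have p1 := prime_gt1 pr_p.
(* The Legendre sum for n! stops at n; its terms up to 2n vanish, so both sums can share one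
   range. *)
have big0 : (\sum_(n.+1 <= k < n.*2.+1) (n %/ p ^ k + n %/ p ^ k) = 0)%N.
  rewrite big_nat_cond big1 // => k /andP[/andP[lt_nk _] _].
  rewrite divn_small // (ltn_trans lt_nk) //; exact: ltn_expl.
have e0 : (0 < e)%N.
  case: e lt_n le_2n {e_log} => //; rewrite expn0 ltnS leqn0 => /eqP->.
  by rewrite double0.
have lt_e : (e < n.*2.+1)%N by rewrite ltnS ltnW // (leq_trans (ltn_expl _ p1)).
have -> : (\sum_(1 <= k < n.+1) (n %/ p ^ k + n %/ p ^ k) =
   \sum_(1 <= k < n.*2.+1) (n %/ p ^ k + n %/ p ^ k))%N.
  rewrite [RHS](@big_cat_nat _ _ _ n.+1) /= ?big0 ?addn0 //.
  by rewrite ltnS -addnn leq_addr.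
rewrite (bigD1_seq e) ?mem_index_iota ?e0 ?iota_uniq //=.
rewrite [X in (_ < X)%N](bigD1_seq e) ?mem_index_iota ?e0 ?iota_uniq //=.
rewrite (divn_small lt_n) !add0n -add1n; apply: leq_add.
  by rewrite divn_gt0 // expn_gt0 ltnW.
apply: leq_sum => k _; rewrite -addnn.
by rewrite leq_divRL ?expn_gt0 ?prime_gt0 // mulnDl leq_add // leq_trunc_div.
Qed.

(** [L] is a product of central binomial coefficients. Doubling the bound raises the largest
    admissible exponent of a prime by at most one, and when it does, the new coefficient C(2n, n),
    at most 4^n, is divisible by that prime. *)
Lemma small_common_multiple j : exists L, [/\ (0 < L)%N, (L <= 4 ^ (2 ^ j))%N &
  forall d, (0 < d <= 2 ^ j)%N -> (d %| L)%N].
Proof.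
suff [L [L0 leL hL]] : exists L, [/\ (0 < L)%N, (L <= 4 ^ (2 ^ j))%N &
    forall p e, prime p -> (p ^ e <= 2 ^ j)%N -> (e <= logn p L)%N].
  exists L; split=> // d /andP[d0 le_d]; apply/dvdn_partP => // p.
  rewrite mem_primes => /and3P[pr_p _ _].
  rewrite p_part pfactor_dvdn //; apply: hL => //.
  by apply: leq_trans le_d; apply: dvdn_leq => //; exact: pfactor_dvdnn.
elim: j => [|j [L [L0 leL hL]]].
  exists 1%N; split=> // p [|e] pr_p //; rewrite expn0 leqNgt => /negP[].
  exact: (leq_trans (prime_gt1 pr_p) (leq_pexp2l (prime_gt0 pr_p) (ltn0Sn e))).
pose n := (2 ^ j)%N.
have n2 : (2 ^ j.+1 = n.*2)%N by rewrite expnS mul2n.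
have C0 : (0 < 'C(n.*2, n))%N by rewrite bin_gt0 -addnn leq_addr.
exists (L * 'C(n.*2, n))%N; split; first by rewrite muln_gt0 L0.
  rewrite n2 -[in X in (_ <= X)%N]addnn expnD; apply: leq_mul => //.
  rewrite -[4%N]/(2 ^ 2)%N -expnM mul2n.
  have -> : (2 ^ n.*2 = \sum_(k < n.*2.+1) 'C(n.*2, k))%N.
    by rewrite -[2%N]/(1 + 1)%N expnDn; apply: eq_bigr => i _; rewrite !exp1n !muln1.
  have lt_n : (n < n.*2.+1)%N by rewrite ltnS -addnn leq_addr.
  by rewrite (bigD1 (Ordinal lt_n)) //= leq_addr.
move=> p e pr_p le_pe; rewrite lognM //.
have [le_n|lt_n] := leqP (p ^ e) n.
  by apply: leq_trans (leq_addr _ _); exact: hL.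
have pC : (p %| 'C(n.*2, n))%N.
  by apply: (prime_dvd_central_bin (e := e)); rewrite // lt_n -n2.
have l1 : (0 < logn p 'C(n.*2, n))%N.
  by rewrite -pfactor_dvdn // expn1.
case: e le_pe lt_n => // e le_pe lt_n.
rewrite -addn1; apply: leq_add => //; apply: hL => //.
rewrite -(@leq_pmul2l 2) // -expnS; apply: leq_trans le_pe.
by rewrite expnS leq_mul2r (prime_gt1 pr_p) orbT.
Qed.

End CommonMultiples.

(** * The upper central series and homomorphisms to the centre *)

Section UpperCentralSeries.
Local Open Scope group_scope.
Variable G : groupType.
Implicit Types (M V N : set G) (x y z g : G).

Fixpoint upper_central_series (i : nat) : set G :=
  if i is j.+1 then [set x | forall y, upper_central_series j [~ x, y]]
  else [set 1].
Local Notation UCS := upper_central_series.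

Lemma upper_central_sub i : UCS i `<=` UCS i.+1.
Proof.
elim: i => [x -> y|i IH x Ux y]; first by rewrite comm1g.
by apply: IH; exact: Ux.
Qed.

Lemma upper_central_comm i x y : UCS i x -> UCS i [~ x, y].
Proof.
case: i => [->|i Ux]; first by rewrite comm1g.
by apply: upper_central_sub; exact: Ux.
Qed.

Lemma upper_central_subgroup i : subgroup (UCS i).
Proof.
elim: i => [|i sU]; first exact: subgroup_set1.
split=> [y|x y Ux Uy z]; first by rewrite comm1g; exact: (subgroup1 sU).
rewrite commMgR commVgR; do 2?apply: (subgroupM sU).
- exact: Ux.
- by apply: upper_central_comm; exact: Ux.
- by apply: (subgroupV sU); exact: Uy.
- by apply: upper_central_comm; apply: (subgroupV sU); exact: Uy.
Qed.

Lemma upper_central1 x : UCS 1 x -> group_center G x.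
Proof. by move=> Ux y; apply/commgP/eqP; exact: Ux. Qed.

Lemma lower_upper_central c i : lower_central_series G c = [set 1] ->
  lower_central_series G (c - i) `<=` UCS i.
Proof.
move=> nil; elim: i => [|i IH]; first by rewrite subn0 nil.
have [le_ci|lt_ic] := leqP c i.
  apply: subset_trans (@upper_central_sub i); apply: subset_trans IH.
  by apply: lower_central_leq; lia.
move=> x Lx y; apply: IH; have -> : (c - i = (c - i.+1).+1)%N by lia.
exact: lower_central_comm.
Qed.

(** [phi] is an iterated commutator [[u, y_1], ..., y_i], the y_j being chosen so that it survives
    at [x]. It is multiplicative because the correction [[u, y], v] falls into a term that the
    remaining commutators kill. *)
Lemma central_character_step i x : UCS i.+1 x -> ~ UCS i x ->
  exists phi : G -> G, [/\
    forall u v, UCS i.+1 u -> UCS i.+1 v -> phi (u * v) = phi u * phi v,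
    forall u, UCS i.+1 u -> group_center G (phi u),
    forall u, UCS i u -> phi u = 1,
    phi x <> 1 &
    forall N, normal_in N [set: G] -> forall u, N u -> N (phi u)].
Proof.
elim: i x => [|i IH] x Ux nUx.
  by exists id; split=> // u; exact: upper_central1.
have [y nUy] : exists y, ~ UCS i [~ x, y].
  by apply: contrapT => h; apply: nUx => y; apply: contrapT => nU; apply: h; exists y.
have [phi [phiM phiZ phi1 phix phiN]] := IH _ (Ux y) nUy.
have sU := upper_central_subgroup i.+1.
exists (fun u => phi [~ u, y]); split=> //.
- move=> u v Uu Uv; rewrite commMgR.
  have Uuy : UCS i.+1 [~ u, y] := Uu y.
  have Uvy : UCS i.+1 [~ v, y] := Uv y.
  have Uuyv : UCS i [~ [~ u, y], v] := Uuy v.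
  have Uuyv' := upper_central_sub Uuyv.
  rewrite (phiM ([~ u, y] * [~ [~ u, y], v])) //; last exact: (subgroupM sU).
  by rewrite (phiM [~ u, y]) // (phi1 [~ [~ u, y], v]) // mulg1.
- by move=> u Uu; apply: phiZ; exact: Uu.
- by move=> u Uu; apply: phi1; exact: Uu.
- move=> N nN u Nu; apply: phiN => //; have [sN _ _ nNG] := nN.
  rewrite commgEl; apply: (subgroupM sN); first exact: (subgroupV sN).
  exact: nNG.
Qed.

Lemma central_character V x0 : nilpotent_group G -> V x0 -> x0 <> 1 ->
  exists phi : G -> G, [/\
    forall u v, V u -> V v -> phi (u * v) = phi u * phi v,
    forall u, V u -> group_center G (phi u),
    exists2 x, V x & phi x <> 1 &
    forall N, normal_in N [set: G] -> forall u, N u -> N (phi u)].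
Proof.
move=> [c nil] Vx0 x01.
(* For the least term containing [V], the map [phi] of that level is defined on all of [V] and is
   nontrivial on it. *)
have exP : exists i, `[< V `<=` UCS i >].
  exists c; apply/asboolP => x _.
  by apply: (lower_upper_central (i := c) nil); rewrite subnn.
case: (ex_minnP exP) => -[|i] /asboolP VU minP; first by case: x01; exact: VU.
have [x Vx nUx] : exists2 x, V x & ~ UCS i x.
  apply: contrapT => h; have /minP : `[< V `<=` UCS i >].
    by apply/asboolP => x Vx; apply: contrapT => nU; apply: h; exists x.
  by rewrite ltnn.
have [phi [phiM phiZ phi1 phix phiN]] := central_character_step (VU _ Vx) nUx.
exists phi; split=> //.
- by move=> u v /VU Uu /VU Uv; exact: phiM.
- by move=> u /VU Uu; exact: phiZ.
- by exists x.
Qed.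

End UpperCentralSeries.

Section LowerBound.
Local Open Scope group_scope.
Variable G : groupType.
Implicit Types (V N : set G) (x y z : G).

(* Each step of the series of kernels of the characters psi \o phi, where phi maps
   the current subgroup to Z(G), contributes a factor of order M. *)
Lemma index_lower_bound (psi : G -> int) V k : nilpotent_group G ->
  additive_on (group_center G) psi ->
  (forall z, group_center G z -> psi z = 0%R -> z = 1) ->
  polycyclic V k ->
  exists2 D : nat, (0 < D)%N & forall (M : nat) N, normal_in N [set: G] ->
    (forall z, group_center G z -> N z -> psi z <> 0%R -> (M < `|psi z|)%N) ->
    exists s : seq G, [/\ uniq s, {in s, forall x, V x},
      {in s &, forall x y, N (x^-1 * y) -> x = y} & (M ^ k <= D * size s)%N].
Proof.
move=> nilG apsi psi0; have sZ := @subgroup_center G.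
elim: k V => [|k IH] V pV; have sV := polycyclic_subgroup pV.
  exists 1%N => // M N _ _; exists [:: 1]; split=> //.
    by move=> x; rewrite inE => /eqP->; exact: subgroup1.
  by move=> x y; rewrite !inE => /eqP-> /eqP->.
have [x0 Vx0 x01] : exists2 x0, V x0 & x0 <> 1.
  apply: contrapT => h; suff : k.+1 = 0%N by [].
  apply: (finite_group_polycyclic pV); exists [:: 1] => x Vx; exists 1.
    by rewrite inE.
  by rewrite invg1 mul1g /=; apply: contrapT => x1; apply: h; exists x.
have [phi [phiM phiZ [x Vx phix] phiN]] := central_character nilG Vx0 x01.
pose lam u := psi (phi u).
have alam : additive_on V lam.
  by move=> u v Vu Vv; rewrite /lam phiM // apsi //; exact: phiZ.
have lamx : lam x != 0%R by apply/eqP => /psi0 h; apply: phix; apply: h; exact: phiZ.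
have [lam' [c [c0 alam' lamE [t Vt lt]]]] := additive_on_normalize sV alam Vx lamx.
have [k' [<-] pker] := polycyclic_kernel_on sV alam' Vt lt pV.
have [D D0 hD] := IH _ pker.
exists (c * D)%N => [|M N nN hN]; first by rewrite muln_gt0 c0.
have [s [us sV' sN sz_s]] := hD M N nN hN.
(* Powers of [t] with distinct exponents below [q] stay apart modulo [N]: their difference would
   give a value of [psi] that is nonzero and at most c (q - 1), hence at most [M]. As c q is at
   least [M], only the constant [c] is lost. *)
pose q := (M %/ c).+1; have [sN' _ _ _] := nN.
have key (a b : nat) y z : (a < q)%N -> (b < q)%N -> y \in s -> z \in s ->
    N ((t ^+ a * y)^-1 * (t ^+ b * z)) -> a = b /\ y = z.
  move=> lt_a lt_b ys zs; set u := _ * _ => Nu.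
  have [Vy ly] := sV' _ ys; have [Vz lz] := sV' _ zs.
  have Vta : V (t ^+ a) by exact: subgroupX.
  have Vtb : V (t ^+ b) by exact: subgroupX.
  have Vay : V (t ^+ a * y) by exact: subgroupM.
  have Vbz : V (t ^+ b * z) by exact: subgroupM.
  have Vu : V u by apply: subgroupM => //; exact: subgroupV.
  have lX (n : nat) : lam' (t ^+ n) = Posz n.
    by have := additive_on_zpow sV alam' n%:Z Vt; rewrite zpow_nat lt mulr1.
  have lu : lam' u = (b%:Z - a%:Z)%R.
    rewrite alam' //; last exact: subgroupV.
    by rewrite (additive_onV sV) // !alam' // ly lz !lX; ring.
  have ab : a = b.
    have [e|] := pselect (psi (phi u) = 0%R).
      have := lamE _ Vu; rewrite /lam e lu => /esym/eqP.
      by rewrite mulf_eq0 subr_eq0 => /orP[|] /eqP; lia.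
    move=> /(hN _ (phiZ _ Vu) (phiN _ nN _ Nu)).
    rewrite -/(lam u) lamE // lu abszM absz_nat => lt_M.
    have : (c * `|(b%:Z - a%:Z)%R| <= c * (M %/ c))%N.
      rewrite leq_mul2l; apply/orP; right; rewrite /q in lt_a lt_b; lia.
    move/(leq_trans lt_M); rewrite mulnC => /leq_trans/(_ (leq_trunc_div M c)).
    by rewrite ltnn.
  split=> //; apply: sN => //; move: Nu.
  by rewrite /u ab invgM -mulgA mulKg.
have le_M : (M <= c * q)%N by rewrite mulnC; apply: ltnW; exact: ltn_ceil.
clearbody q.
exists [seq t ^+ a * y | a <- iota 0 q, y <- s]; split.
- apply: allpairs_uniq => //; first exact: iota_uniq.
  move=> _ _ /allpairsP[[a y] [/= ia ys ->]] /allpairsP[[b z] [/= ib zs ->]] /= e.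
  move: ia ib; rewrite !mem_iota !add0n /= => lt_a lt_b.
  have [|-> ->] // := key a b y z lt_a lt_b ys zs.
  by rewrite e mulVg; exact: (subgroup1 sN').
- move=> _ /allpairsP[[a y] [/= _ ys ->]]; apply: subgroupM => //.
    exact: subgroupX.
  by have [] := sV' _ ys.
- move=> _ _ /allpairsP[[a y] [/= ia ys ->]] /allpairsP[[b z] [/= ib zs ->]] /=.
  move: ia ib; rewrite !mem_iota !add0n /= => lt_a lt_b /(key a b y z lt_a lt_b ys zs).
  by move=> [-> ->].
- rewrite size_allpairs size_iota expnS.
  have -> : (c * D * (q * size s) = (c * q) * (D * size s))%N by ring.
  exact: leq_mul.
Qed.

End LowerBound.

(** * Residual depth and residual growth *)

Section NatExtrema.

Lemma nat_min_in (A : set nat) k : A k -> A (nat_min A).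
Proof.
move=> Ak; have exA : exists k, `[< A k >] by exists k; apply/asboolP.
case: (ex_minnP exA) => m /asboolP Am minA.
suff : (A `&` lbound A) (nat_min A) by case.
apply: (@xgetPex _ 0%N (A `&` lbound A)); exists m; split=> // n An.
by rewrite leEnat; apply: minA; apply/asboolP.
Qed.

Lemma nat_min_le (A : set nat) k : A k -> (nat_min A <= k)%N.
Proof.
move=> Ak; have exA : exists k, `[< A k >] by exists k; apply/asboolP.
case: (ex_minnP exA) => m /asboolP Am minA.
suff [_] : (A `&` lbound A) (nat_min A) by apply.
apply: (@xgetPex _ 0%N (A `&` lbound A)); exists m; split=> // n An.
by rewrite leEnat; apply: minA; apply/asboolP.
Qed.

Lemma nat_max_le (A : set nat) B : (forall k, A k -> (k <= B)%N) ->
  (nat_max A <= B)%N.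
Proof.
move=> hB; rewrite /nat_max; case: xgetP => [m _ [/hB //]|_]; exact: leq0n.
Qed.

Lemma le_nat_max (A : set nat) B k : (forall k, A k -> (k <= B)%N) -> A k ->
  (k <= nat_max A)%N.
Proof.
move=> hB Ak; have exA : exists k, `[< A k >] by exists k; apply/asboolP.
have hB' i : `[< A i >] -> (i <= B)%N by move=> /asboolP/hB.
case: (ex_maxnP exA hB') => m /asboolP Am maxA.
suff [_] : (A `&` ubound A) (nat_max A) by apply.
apply: (@xgetPex _ 0%N (A `&` ubound A)); exists m; split=> // n An.
by rewrite leEnat; apply: maxA; apply/asboolP.
Qed.

End NatExtrema.

Section FiniteQuotient.
Local Open Scope group_scope.
Variables (G : groupType) (N : set G) (s : seq G).
Hypothesis nN : normal_in N [set: G].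
Hypothesis hs : forall x, exists2 y, y \in s & N (y^-1 * x).

Local Notation T := (quotient_group N).
Let e : seq T := undup [seq quotient_map N y | y <- s].

Let mem_e (v : T) : v \in e.
Proof.
have [x <-] := quotient_map_surj v; have [y ys Ny] := hs x.
rewrite mem_undup; apply/mapP; exists y => //.
have /(quotient_map_eq1 nN) : N (y^-1 * x) by [].
rewrite quotient_mapM (epiV (@quotient_mapM _ N)).
move=> /(congr1 (fun v => quotient_map N y * v)).
by rewrite mulVKg mulg1.
Qed.

Lemma finite_quotient : exists (Q : finGroupType) (phi : {multiplicative G -> Q}),
  [/\ set_surj [set: G] [set: Q] phi, forall x, phi x = 1 <-> N x &
    (#|Q| <= size s)%N].
Proof.
(* The quotient becomes a [finGroupType] by numbering its elements along [e]. *)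
have pK : pcancel (fun v : T => index v e) (fun n => Some (nth 1 e n)).
  by move=> v; rewrite nth_index.
pose cT := Choice_isCountable.Build T pK.
have fA : Finite.axiom e by move=> v; rewrite count_uniq_mem ?undup_uniq ?mem_e.
pose fT := fintype.isFinite.Build T fA.
pose Q : finGroupType := HB.pack T cT fT.
pose mphi := isMultiplicative.Build G Q (quotient_map N : G -> Q) (@quotient_mapM G N).
pose phi : {multiplicative G -> Q} := HB.pack (quotient_map N : G -> Q) mphi.
exists Q, phi; split.
- by move=> v _; have [x <-] := quotient_map_surj (v : T); exists x.
- by move=> x; exact: quotient_map_eq1.
- have -> : #|Q| = #|(e : seq Q)|.
    by apply: eq_card => v; rewrite (mem_e (v : T)).
  apply: leq_trans (card_size _) _.
  by apply: leq_trans (size_undup _) _; rewrite size_map.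
Qed.

End FiniteQuotient.

Section ResidualDepth.
Local Open Scope group_scope.
Variable G : groupType.
Implicit Types (S N : set G) (x : G) (w : seq G).

Lemma residual_depth_le N B x : normal_in N [set: G] -> ~ N x -> index_le N B ->
  (residual_depth x <= B)%N.
Proof.
move=> nN Nx [s sz_s hs]; have [Q [phi [sphi phi1 le_Q]]] := finite_quotient nN hs.
apply: leq_trans (leq_trans le_Q sz_s); apply: nat_min_le.
by exists Q, phi; split=> // /phi1.
Qed.

(** The separating subgroup [N] of finite index excludes the default value 0 of [nat_min], so the
    depth is the order of an actual quotient. *)
Lemma residual_depthP N B x (P : nat -> Prop) :
  normal_in N [set: G] -> ~ N x -> index_le N B ->
  (forall (Q : finGroupType) (phi : {multiplicative G -> Q}),
    phi x <> 1 -> P #|Q|) -> P (residual_depth x).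
Proof.
move=> nN Nx [s sz_s hs] hP.
have [Q [phi [sphi phi1 le_Q]]] := finite_quotient nN hs.
rewrite /residual_depth; set A := [set k | _].
have AQ : A #|Q| by exists Q, phi; split=> // /phi1.
by have [Q' [phi' [_ phix ->]]] := nat_min_in AQ; exact: hP phix.
Qed.

Lemma exists_spelling S x : generated_subgroup S = [set: G] ->
  exists w, spells S w x.
Proof.
move=> genS; suff : generated_subgroup S `<=` [set x | exists w, spells S w x].
  by rewrite genS => /(_ x I).
apply: generated_min => [|y Sy]; last first.
  exists [:: y]; split; last by rewrite big_seq1.
  by move=> z; rewrite inE => /eqP->; left.
split=> [|y z [u [hu eu]] [v [hv ev]]].
  by exists [::]; split=> //; rewrite big_nil.
exists (u ++ rev [seq a^-1 | a <- v]); split.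
  move=> a; rewrite mem_cat => /orP[/hu //|].
  rewrite mem_rev => /mapP[b /hv[Sb|Sb] ->]; [right|left] => //.
  by rewrite invgK.
rewrite big_cat /= eu -ev; congr (_ * _).
elim: v {hv ev} => [|a v IH]; first by rewrite /= !big_nil invg1.
by rewrite map_cons rev_cons -cats1 big_cat big_seq1 big_cons invgM IH.
Qed.

Lemma word_length_spelling S x : generated_subgroup S = [set: G] ->
  exists2 w, spells S w x & size w = word_length S x.
Proof.
move=> genS; have [w0 hw0] := exists_spelling x genS.
rewrite /word_length; set A := [set size w | w in _].
have A0 : A (size w0) by exists w0.
by have [w hw e] := nat_min_in A0; exists w.
Qed.

Lemma word_lengthX S w x n : spells S w x -> (word_length S (x ^+ n) <= n * size w)%N.
Proof.
move=> [hw ew]; apply: nat_min_le; exists (flatten (nseq n w)); last first.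
  by rewrite size_flatten /shape map_nseq sumn_nseq mulnC.
split=> [a /flattenP[u /nseqP[-> _]]|]; first exact: hw.
elim: n => [|n IH]; first by rewrite big_nil.
by rewrite /= big_cat /= IH ew expgS.
Qed.

Lemma spelling_letters S : finite_set S -> exists s : seq G,
  forall w x, spells S w x -> {subset w <= s} /\ x = \prod_(a <- w) a.
Proof.
move=> /finite_seqP[r ->]; exists (r ++ [seq a^-1 | a <- r]) => w x [hw <-].
split=> // a /hw[ra|ra]; rewrite mem_cat; apply/orP; [by left|right].
by apply/mapP; exists a^-1 => //; rewrite invgK.
Qed.

Lemma residual_depth_log S h : finite_set S -> generated_subgroup S = [set: G] ->
  finite_index (torsion G) [set 1] ->
  (forall s, log_separated s [set: G] h) ->
  exists C : nat, forall n x, (word_length S x <= n)%N ->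
    (residual_depth x <= C * (trunc_log 2 n.+1).+1 ^ h)%N.
Proof.
move=> finS genS [r hr] sepG; have [s hs] := spelling_letters finS.
have [C hC] := sepG s.
(* The list [r] contains all torsion elements, and the sum bounds their depths. *)
exists (C + \sum_(y <- r) residual_depth y)%N => n x.
have [w hw <-] := word_length_spelling x genS => le_wn.
have [sw ex] := hs _ _ hw.
have [/hr[y ry /= yx]|ntx] := pselect (torsion G x).
  have -> : x = y by rewrite -[x](mulKVg y) yx mulg1.
  apply: leq_trans (leq_pmulr _ _); last by rewrite expn_gt0.
  by rewrite (big_rem y) //= addnCA leq_addr.
rewrite ex in ntx; have [N [nN Nx iN]] := hC w sw I ntx.
rewrite -ex in Nx.
apply: leq_trans (residual_depth_le nN Nx iN) _.
apply: leq_mul; first exact: leq_addr.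
case: (h) => // h'; rewrite leq_exp2r // ltnS.
by apply: leq_trunc_log; rewrite ltnS.
Qed.

Lemma residual_growth_le S C h n : (forall n x, (word_length S x <= n)%N ->
    (residual_depth x <= C * (trunc_log 2 n.+1).+1 ^ h)%N) ->
  (residual_growth S n <= C * (trunc_log 2 n.+1).+1 ^ h)%N.
Proof. by move=> hC; apply: nat_max_le => _ [x [_ lx] <-]; exact: hC. Qed.

(** The uniform bound on depths guarantees that the maximum exists, as [nat_max] is 0 on an
    unbounded set. *)
Lemma le_residual_growth S C h n x : (forall n x, (word_length S x <= n)%N ->
    (residual_depth x <= C * (trunc_log 2 n.+1).+1 ^ h)%N) ->
  x <> 1 -> (word_length S x <= n)%N ->
  (residual_depth x <= residual_growth S n)%N.
Proof.
move=> hC x1 lx; apply: (le_nat_max (B := C * (trunc_log 2 n.+1).+1 ^ h)).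
  by move=> _ [y [_ ly] <-]; exact: hC.
by exists x.
Qed.

Lemma log_separated_leq (s : seq G) (V : set G) h h' : (h <= h')%N ->
  log_separated s V h -> log_separated s V h'.
Proof.
move=> le_h [C hC]; exists C => w ws x Vx ntx.
have [N [nN Nx [r sz_r hr]]] := hC w ws Vx ntx.
exists N; split=> //; exists r => //; apply: leq_trans sz_r _.
by rewrite leq_mul2l leq_pexp2l ?orbT.
Qed.

End ResidualDepth.

(** * The torsion-free quotient *)

Section TorsionFree.
Local Open Scope group_scope.
Variable G : groupType.
Implicit Types (A V N : set G) (x y z : G).

Definition torsion_free := forall x, torsion G x -> x = 1.

Lemma torsion_free_finite V : torsion_free -> subgroup V ->
  finite_index V [set 1] -> forall x, V x -> x = 1.
Proof.
move=> tfG sV finV x Vx; have [n n0 hn] := finite_group_exponent sV finV.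
by apply: tfG; exists n => //; exact: hn.
Qed.

Lemma upper_central_leq (i j : nat) : (i <= j)%N ->
  @upper_central_series G i `<=` upper_central_series j.
Proof.
elim: j => [|j IH]; first by rewrite leqn0 => /eqP->.
rewrite leq_eqVlt => /orP[/eqP->//|]; rewrite ltnS => /IH h.
exact: subset_trans h (@upper_central_sub _ _).
Qed.

Lemma upper_central_setT c : lower_central_series G c = [set 1] ->
  forall x, upper_central_series c x.
Proof. by move=> nil x; apply: (lower_upper_central (i := c) nil); rewrite subnn. Qed.

(** If [x] is not central, a homomorphism [phi] on its level of the upper central series kills the
    centre but not [x]; then phi(x)^n = 1, against torsion-freeness. *)
Lemma root_of_central x n : torsion_free -> nilpotent_group G -> (0 < n)%N ->
  group_center G (x ^+ n) -> group_center G x.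
Proof.
move=> tfG [c nil] n0 Zx; apply: contrapT => nZx.
have exP : exists i, `[< upper_central_series i x >].
  by exists c; apply/asboolP; exact: upper_central_setT.
case: (ex_minnP exP) => -[|[|i]] /asboolP Ux minP.
- by apply: nZx => y; move: Ux => /= ->; rewrite mulg1 mul1g.
- by apply: nZx; exact: upper_central1.
have nUx : ~ upper_central_series i.+1 x.
  by move=> Ux'; have := minP i.+1 (asboolT Ux'); rewrite ltnn.
have [phi [phiM _ phi1 phix _]] := central_character_step Ux nUx.
have sU := @upper_central_subgroup G i.+2.
have phiX (k : nat) : phi (x ^+ k) = phi x ^+ k.
  elim: k => [|k IHk].
    by apply: phi1; apply: (subgroup1 (@upper_central_subgroup G i.+1)).
  by rewrite !expgS phiM ?IHk //; exact: (subgroupX _ sU Ux).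
apply: phix; apply: tfG; exists n => //; rewrite -phiX; apply: phi1.
apply: (upper_central_leq (i := 1)) => // y.
by apply/eqP/commgP; exact: Zx.
Qed.

Lemma central_normal A : subgroup A -> A `<=` group_center G ->
  normal_in A [set: G].
Proof.
move=> sA AZ; split=> // x y Ax _.
by rewrite conjgE (AZ _ Ax) mulKg.
Qed.

Lemma torsion_free_quotient N : normal_in N [set: G] ->
  (forall x n, (0 < n)%N -> N (x ^+ n) -> N x) ->
  forall v : quotient_group N, torsion _ v -> v = 1.
Proof.
move=> nN isoN v [n n0]; have [x <-] := quotient_map_surj v.
rewrite -(epiX (@quotient_mapM G N)) => /(quotient_map_eq1 nN) /(isoN _ _ n0).
by move=> Nx; apply/(quotient_map_eq1 nN).
Qed.

Lemma polycyclic_sub A h : polycyclic [set: G] h -> subgroup A ->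
  exists k, polycyclic A k.
Proof.
by move=> pG sA; have [k []] := polycyclic_setI pG sA; rewrite setIT; exists k.
Qed.

Lemma quotient_map_preimage1 N : normal_in N [set: G] ->
  @quotient_map G N @^-1` [set 1] = N.
Proof.
move=> nN; apply/seteqP; split=> x; first by move/(quotient_map_eq1 nN).
by move=> Nx; apply/(quotient_map_eq1 nN).
Qed.

Lemma polycyclic_quotient N h a : normal_in N [set: G] ->
  polycyclic [set: G] h -> polycyclic N a ->
  exists2 b, h = (a + b)%N & polycyclic [set: quotient_group N] b.
Proof.
move=> nN pG pN.
have [b pb] := polycyclic_image (@quotient_mapM G N) pG.
have eT : quotient_map N @` [set: G] = [set: quotient_group N].
  apply/seteqP; split=> // v _; have [x <-] := quotient_map_surj v.
  by exists x.
rewrite eT in pb; exists b => //; apply: (polycyclic_uniq pG).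
have := polycyclic_preimage (@quotient_mapM G N) (@quotient_map_surj G N) _ pb.
by rewrite quotient_map_preimage1 // preimage_setT; apply.
Qed.

(** A nontrivial subgroup of a torsion-free group is infinite, so the quotient by [A] has smaller
    Hirsch length; its exponent is then rounded up to h - 1. *)
Lemma central_quotient_separated A h : torsion_free -> nilpotent_group G ->
  polycyclic [set: G] h -> subgroup A -> A `<=` group_center G ->
  (exists2 x, A x & x <> 1) ->
  (forall x n, group_center G x -> (0 < n)%N -> A (x ^+ n) -> A x) ->
  exists2 h', h = h'.+1 & forall s : seq (quotient_group A),
    log_separated s [set: quotient_group A] h'.
Proof.
move=> tfG nilG pG sA AZ [x0 Ax0 x01] isoA.
have nA := central_normal sA AZ.
have [a pA] := polycyclic_sub pG sA.
have a0 : (0 < a)%N.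
  case: a pA => // pA; case: x01.
  exact: (torsion_free_finite tfG sA (polycyclic0_finite pA)).
have [b -> pb] := polycyclic_quotient nA pG pA.
exists (a + b).-1 => [|s]; first by rewrite prednK // addn_gt0 a0.
apply: (log_separated_leq (h := b)); first by lia.
apply: log_separated_setT pb.
exact: (nilpotent_image (@quotient_mapM G A) (@quotient_map_surj G A)).
Qed.

End TorsionFree.

Section Pullback.
Local Open Scope group_scope.
Variables (G H : groupType) (p : G -> H).
Hypotheses (pM : forall x y, p (x * y) = p x * p y).
Hypotheses (pS : forall y, exists x, p x = y).

Lemma separated_pullback (s : seq G) h :
  log_separated [seq p a | a <- s] [set: H] h -> exists C : nat,
  forall w : seq G, {subset w <= s} ->
    let x := \prod_(a <- w) a in ~ torsion H (p x) ->
    exists N, [/\ normal_in N [set: G], ~ N x &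
      index_le N (C * (trunc_log 2 (size w).+1).+1 ^ h)].
Proof.
move=> [C hC]; exists C => w ws x ntx.
have ex : p x = \prod_(b <- [seq p a | a <- w]) b.
  rewrite big_map; apply: (big_morph p) => //; exact: epi1.
have pws : {subset [seq p a | a <- w] <= [seq p a | a <- s]}.
  by move=> _ /mapP[a /ws sa ->]; exact: map_f.
have := hC _ pws I; rewrite -ex => /(_ ntx)[N [[sN _ _ nN] Nx [r sz_r hr]]].
rewrite size_map in sz_r.
exists (p @^-1` N); split=> //.
  split=> //; first exact: subgroup_preimage.
  by move=> u v Nu _; rewrite /preimage /= (epiJ pM); exact: nN.
have /choice[f hf] := pS.
exists [seq f v | v <- r]; first by rewrite size_map.
move=> u; have [v vr Nv] := hr (p u); exists (f v); first exact: map_f.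
by rewrite /preimage /= pM (epiV pM) hf.
Qed.

End Pullback.

Section TorsionQuotient.
Local Open Scope group_scope.
Variables (Gamma : groupType) (h : nat).
Hypotheses (nilGamma : nilpotent_group Gamma) (pGamma : polycyclic [set: Gamma] h).

Local Notation T := (torsion Gamma).
Local Notation G := (quotient_group T).
Local Notation pi := (@quotient_map Gamma T).

Lemma torsion_finite : finite_index T [set 1].
Proof. by have [_] := polycyclic_torsion nilGamma pGamma; rewrite setIT. Qed.

Lemma torsion_normal : normal_in T [set: Gamma].
Proof.
have [sT _] := polycyclic_torsion nilGamma pGamma; rewrite setIT in sT.
split=> // x y [n n0 xn] _; exists n => //.
by rewrite -conjXg xn conj1g.
Qed.

Lemma torsion_quotient_torsion_free : torsion_free G.
Proof.
apply: torsion_free_quotient; first exact: torsion_normal.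
move=> x n n0 [m m0 xnm]; exists (n * m)%N; first by rewrite muln_gt0 n0.
by rewrite expgnA.
Qed.

Lemma torsion_quotient_nilpotent : nilpotent_group G.
Proof. exact: (nilpotent_image (@quotient_mapM _ T) (@quotient_map_surj _ T)). Qed.

Lemma torsion_quotient_polycyclic : polycyclic [set: G] h.
Proof.
have [sT _ _ _] := torsion_normal.
have [a pT] := polycyclic_sub pGamma sT.
have a0 := finite_group_polycyclic pT torsion_finite; rewrite a0 in pT.
by have [b -> pb] := polycyclic_quotient torsion_normal pGamma pT.
Qed.

Let tfG := torsion_quotient_torsion_free.
Let nilG := torsion_quotient_nilpotent.
Let pG := torsion_quotient_polycyclic.
Let Z := group_center G.
Let sZ : subgroup Z := @subgroup_center G.

(** A finite centre of the torsion-free quotient is trivial, so by nilpotency the quotient is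
    trivial and [Gamma] equals its finite torsion subgroup. *)
Lemma center_hirsch_neq0 : infinite_set [set: Gamma] -> ~ polycyclic Z 0.
Proof.
move=> infGamma pZ.
have Z1 := torsion_free_finite tfG sZ (polycyclic0_finite pZ).
have G1 (v : G) : v = 1.
  apply: contrapT => v1.
  have [phi [_ phiZ [u _ phiu] _]] := central_character nilG (I : [set: G] v) v1.
  by apply: phiu; apply: Z1; exact: phiZ.
have [s hs] := torsion_finite.
apply: infGamma; apply: (sub_finite_set (B := [set` s])); last exact: finite_seq.
move=> x _; have /(quotient_map_eq1 torsion_normal)/hs[y ys /=] := G1 (pi x).
by move=> yx; rewrite -[x](mulKVg y) yx mulg1.
Qed.

Lemma center_character r : polycyclic Z r.+1 -> exists psi : G -> int,
  [/\ additive_on Z psi, exists2 t, Z t & psi t = 1%R &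
    polycyclic (kernel_on Z psi) r].
Proof.
move=> pZ; have infZ : ~ finite_index Z [set 1].
  by move=> /(finite_group_polycyclic pZ).
have [psi apsi [t Zt pt]] := exists_character nilG pZ infZ.
have [r' [<-] pker] := polycyclic_kernel_on sZ apsi Zt pt pZ.
by exists psi; split=> //; exists t.
Qed.

Lemma separated_large_center r : polycyclic Z r.+2 ->
  exists2 h', h = h'.+1 & forall s : seq Gamma, log_separated s [set: Gamma] h'.
Proof.
move=> pZ; have [psi [apsi [t Zt pt] pker]] := center_character pZ.
have psiX x n : Z x -> psi (x ^+ n) = (n%:Z * psi x)%R.
  by move=> Zx; rewrite -zpow_nat (additive_on_zpow sZ apsi).
pose A1 := kernel_on Z psi.
(* The isolator of the cyclic group of [t] in the centre. It meets the kernel of [psi] trivially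
   because [psi t] is 1 and [G] is torsion-free. *)
pose A2 : set G := [set y | Z y /\ exists2 n : nat, (0 < n)%N &
  exists k, y ^+ n = zpow t k].
have Zcomm x y : Z x -> commute x y by move=> Zx; exact: Zx.
have nA1 := normal_in_kernel_on sZ apsi; have [sA1 _ _ _] := nA1.
have sA2 : subgroup A2.
  split; first by split; [exact: subgroup1|exists 1%N => //; exists 0%R].
  move=> x y [Zx [n n0 [k xn]]] [Zy [m m0 [l ym]]]; split; first exact: sZ.2.
  exists (n * m)%N; first by rewrite muln_gt0 n0.
  exists (k * m%:Z - l * n%:Z)%R.
  rewrite expgnFl; last exact: Zcomm.
  rewrite expgnA xn mulnC expgnA ym -!zpowMn zpowD zpowN //.
have A1A2 x : A1 x -> A2 x -> x = 1.
  move=> [Zx px] [_ [n n0 [k xn]]].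
  have := psiX x n Zx; rewrite px mulr0 xn (additive_on_zpow sZ apsi) // pt mulr1.
  by move=> k0; apply: tfG; exists n => //; rewrite xn k0.
have [|||h1 eh1 sep1] := central_quotient_separated tfG nilG pG sA1.
- by move=> x [].
- apply: contrapT => h0; have := finite_group_polycyclic pker.
  suff fin : finite_index A1 [set 1] by move=> /(_ fin).
  exists [:: 1] => x Ax; exists 1; first by rewrite inE.
  rewrite invg1 mul1g /=; apply: contrapT => x1; apply: h0.
  by exists x.
- move=> x n Zx n0 [_]; rewrite psiX // => /eqP; rewrite mulf_eq0.
  by case/orP => [|/eqP px]; [lia|split].
have [|||h2 eh2 sep2] := central_quotient_separated tfG nilG pG sA2.
- by move=> x [].
- exists t; last by move=> t1; move: pt; rewrite t1 (additive_on1 sZ apsi).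
  by split=> //; exists 1%N => //; exists 1%R.
- move=> x n Zx n0 [_ [m m0 [k xnm]]]; split=> //.
  by exists (n * m)%N; [rewrite muln_gt0 n0|exists k; rewrite expgnA].
have e12 : h2 = h1 by move: eh2; rewrite eh1 => -[].
exists h1 => // s; rewrite e12 in sep2.
pose p1 x := quotient_map A1 (pi x); pose p2 x := quotient_map A2 (pi x).
have surj2 A : forall v : quotient_group A, exists x, quotient_map A (pi x) = v.
  move=> v; have [u <-] := quotient_map_surj v.
  by have [x <-] := quotient_map_surj u; exists x.
have mor2 A x y : quotient_map A (pi (x * y)) =
    quotient_map A (pi x) * quotient_map A (pi y).
  by rewrite !quotient_mapM.
have [C1 hC1] := separated_pullback (mor2 A1) (surj2 A1) (sep1 [seq p1 a | a <- s]).
have [C2 hC2] := separated_pullback (mor2 A2) (surj2 A2) (sep2 [seq p2 a | a <- s]).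
exists (C1 + C2)%N => w ws x _ ntx.
have pix1 : pi x <> 1 by move=> /(quotient_map_eq1 torsion_normal).
(* Isolation within the centre is enough: by [root_of_central] the centre is itself isolated in [G],
   so the quotient by [A] is torsion-free. *)
have key A : subgroup A -> A `<=` Z ->
    (forall x n, Z x -> (0 < n)%N -> A (x ^+ n) -> A x) -> ~ A (pi x) ->
    ~ torsion (quotient_group A) (quotient_map A (pi x)).
  move=> sA AZ isoA nAx; have nA := central_normal sA AZ.
  move=> /(torsion_free_quotient nA) e; apply: nAx; apply/(quotient_map_eq1 nA).
  apply: e => y n n0 Ayn; apply: (isoA y n _ n0 Ayn).
  by apply: (root_of_central tfG nilG n0); exact: AZ.
have [A1x|nA1x] := pselect (A1 (pi x)).
  have [|N [nN Nx iN]] := hC2 w ws.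
    apply: key => //; first by move=> y [].
      move=> y n Zy n0 [_ [m m0 [k ynm]]]; split=> //.
      by exists (n * m)%N; [rewrite muln_gt0 n0|exists k; rewrite expgnA].
    by move=> A2x; apply: pix1; exact: A1A2.
  by exists N; split=> //; apply: index_leW iN; rewrite leq_mul2r leq_addl orbT.
have [|N [nN Nx iN]] := hC1 w ws.
  apply: key => //; first by move=> y [].
  move=> y n Zy n0 [_]; rewrite psiX // => /eqP; rewrite mulf_eq0.
  by case/orP => [|/eqP py]; [lia|split].
by exists N; split=> //; apply: index_leW iN; rewrite leq_mul2r leq_addr orbT.
Qed.

(** The witness has length of order 4^(2^j), so 2^j is comparable to its logarithm; powers of 2 are
    dense enough on this scale to cost only a constant. *)
Lemma residual_growth_lower_bound S : finite_set S ->
  generated_subgroup S = [set: Gamma] -> polycyclic Z 1 ->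
  exists D K : nat, forall j n, (K * 4 ^ (2 ^ j) <= n)%N ->
    ((2 ^ j) ^ h <= D * residual_growth S n)%N.
Proof.
move=> finS genS pZ; have [psi [apsi [t Zt pt] pker]] := center_character pZ.
have [sA1 _ _ _] := normal_in_kernel_on sZ apsi.
have ker1 := torsion_free_finite tfG sA1 (polycyclic0_finite pker).
have psi0 z : Z z -> psi z = 0%R -> z = 1 by move=> Zz pz; apply: ker1.
have [D D0 hD] := index_lower_bound nilG apsi psi0 pG.
have [z pz] := quotient_map_surj t.
have [sT _ _ _] := torsion_normal.
have [tau tau0 htau] := finite_group_exponent sT torsion_finite.
have [w hw] := exists_spelling z genS.
have sep s := log_separated_setT s nilGamma pGamma.
have [C hC] := residual_depth_log finS genS torsion_finite sep.
exists D, (tau * size w)%N => j n le_n.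
have [L [L0 le_L hL]] := small_common_multiple j.
(* The factor [tau] removes the torsion ambiguity in lifting from [G] to [Gamma]. *)
pose g := z ^+ (L * tau).
have piX (x : Gamma) (k : nat) : pi (x ^+ k) = pi x ^+ k := epiX (@quotient_mapM _ T) x k.
have psi_tX (k : nat) : psi (t ^+ k) = Posz k.
  by rewrite -zpow_nat (additive_on_zpow sZ apsi) // pt mulr1.
have ntg : ~ torsion Gamma g.
  move=> /(quotient_map_eq1 torsion_normal); rewrite /g piX pz => e.
  have := psi_tX (L * tau)%N; rewrite e (additive_on1 sZ apsi) => e0.
  by move/esym/eqP: e0; rewrite eqz_nat gtn_eqF // muln_gt0 L0.
have g1 : g <> 1 by move=> g1; apply: ntg; exists 1%N; rewrite ?g1 ?expg1.
have lg : (word_length S g <= n)%N.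
  apply: leq_trans (word_lengthX _ hw) _; apply: leq_trans le_n.
  rewrite (_ : L * tau * size w = tau * size w * L)%N; last by ring.
  by rewrite leq_mul2l le_L orbT.
apply: leq_trans (leq_mul (leqnn D) (le_residual_growth hC g1 lg)).
have [s hs] := spelling_letters finS.
have [Cs hCs] := sep s.
have [u hu eu] := word_length_spelling g genS.
have [us eg] := hs _ _ hu.
have [|N [nN Ng iN]] := hCs u us I; first by rewrite -eg.
rewrite -eg in Ng.
apply: (residual_depthP (P := fun k => (2 ^ j) ^ h <= D * k)%N nN Ng iN).
move=> Q phi phig.
have phiM x y : phi (x * y) = phi x * phi y by exact: gmulfM.
pose ker : set Gamma := [set x | phi x = 1].
have nker : normal_in ker [set: Gamma].
  split=> //; last first.
    by move=> x y /= kx _; rewrite /ker /= (epiJ phiM) kx conj1g.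
  split=> [|x y /= kx ky]; first exact: (epi1 phiM).
  by rewrite /ker /= phiM (epiV phiM) kx ky invg1 mulg1.
have piS : pi @` [set: Gamma] = [set: G].
  apply/seteqP; split=> // v _; have [x <-] := quotient_map_surj v.
  by exists x.
have nkerG := normal_in_image (@quotient_mapM _ T) nker; rewrite piS in nkerG.
have [sK _ _ _] := nkerG.
have [|r [ur _ hr le_r]] := hD (2 ^ j)%N (pi @` ker) nkerG.
  (* A nonzero |psi v| up to 2^j would divide [L], making t^L a power of [v] and so an element of
     the image of [ker]. Then z^L lies in [ker] up to a torsion element, and [g] is killed by
     [phi]. *)
  move=> v Zv Kv pv; rewrite ltnNge; apply/negP => le_v.
  have /dvdnP[q eL] : (`|psi v| %| L)%N.
    by apply: hL; rewrite le_v andbT absz_gt0; apply/eqP.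
  have [k hk] : exists k : int, (k * psi v)%R = Posz L.
    by exists (Posz q * sgz (psi v))%R; rewrite eL PoszM abszEsg mulrA.
  have tL : t ^+ L = zpow v k.
    have Ztk : Z (t ^+ L) := subgroupX L sZ Zt.
    have Zvk : Z (zpow v k) := subgroup_zpow k sZ Zv.
    apply: divg1_eq; apply: psi0; first exact: sZ.2.
    rewrite apsi //; last exact: (subgroupV sZ).
    by rewrite (additive_onV sZ) // psi_tX (additive_on_zpow sZ apsi) // hk subrr.
  have [x kx ex] : (pi @` ker) (t ^+ L) by rewrite tL; exact: subgroup_zpow.
  have Tx : T (x^-1 * z ^+ L).
    apply/(quotient_map_eq1 torsion_normal).
    by rewrite quotient_mapM (epiV (@quotient_mapM _ T)) piX pz ex mulVg.
  apply: phig; rewrite /g expgnA (epiX phiM).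
  have -> : phi (z ^+ L) = phi (x^-1 * z ^+ L) by rewrite phiM (epiV phiM) kx invg1 mul1g.
  by rewrite -(epiX phiM) htau // (epi1 phiM).
have /choice[f hf] := @quotient_map_surj Gamma T.
apply: leq_trans le_r _; rewrite leq_mul2l; apply/orP; right.
(* Elements apart modulo the image of [ker] have lifts with distinct images in [Q]. *)
rewrite -(size_map (phi \o f)) -(card_uniqP _) ?max_card //.
rewrite map_inj_in_uniq // => x y xr yr /= e.
apply: hr => //; exists ((f x)^-1 * f y).
  by rewrite /ker /= phiM (epiV phiM) e mulVg.
by rewrite quotient_mapM (epiV (@quotient_mapM _ T)) !hf.
Qed.

End TorsionQuotient.

(** * Comparison with the logarithm *)

Section Logarithms.
Local Open Scope ring_scope.
Variable R : realType.

Lemma ln2_bounds : 2^-1 <= ln 2 :> R /\ ln 2 <= 1 :> R.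
Proof.
split; last first.
  have -> : 2 = 1 + 1 :> R by rewrite -natr1.
  by apply: le_ln1Dx; lra.
have := @le_ln1Dx R (- 2^-1); rewrite (_ : 1 + - 2^-1 = 2^-1); last by lra.
rewrite lnV ?posrE // => h; have := h _; lra.
Qed.

Lemma ln_ge0_nat (n : nat) : 0 <= ln n%:R :> R.
Proof.
case: n => [|n]; first by rewrite ln0.
by apply: ln_ge0; rewrite ler1n.
Qed.

Lemma ln_le_nat (m n : nat) : (0 < m)%N -> (m <= n)%N -> ln m%:R <= ln n%:R :> R.
Proof.
move=> m0 le_mn; rewrite ler_ln ?posrE ?ltr0n ?ler_nat //.
exact: leq_trans le_mn.
Qed.

(** The factor 4 in the argument keeps the right side positive at n = 1, where ln n vanishes. *)
Lemma trunc_log_le_ln (n : nat) : (0 < n)%N ->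
  (trunc_log 2 n.+1).+1%:R <= 3 * ln (4 * n)%:R :> R.
Proof.
move=> n0; set l := trunc_log 2 n.+1.
have [h1 h2] := ln2_bounds.
have le1 : l%:R * ln 2 <= ln (4 * n)%:R :> R.
  rewrite mulr_natl -lnXn // -natrX; apply: ln_le_nat; first by rewrite expn_gt0.
  by apply: leq_trans (trunc_logP _ _) _ => //; lia.
have le2 : 1 <= ln (4 * n)%:R :> R.
  apply: (@le_trans _ _ (ln 4%:R)); last by apply: ln_le_nat => //; lia.
  by rewrite (_ : 4 = 2 ^ 2)%N // natrX lnXn // mulr2n; lra.
have l0 : 0 <= l%:R :> R by [].
have : l%:R * 2^-1 <= l%:R * ln 2 :> R by apply: ler_wpM2l.
by move=> le3; rewrite -(@natr1 _ l); lra.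
Qed.

(** Take the largest j with 4^(2^j) at most 4 n; the factor 4 makes it exist already for n = 1. *)
Lemma ln_le_double_power (n : nat) : (0 < n)%N ->
  exists2 j, (4 ^ (2 ^ j) <= 4 * n)%N & ln n%:R <= 4 * (2 ^ j)%:R :> R.
Proof.
move=> n0; pose m := trunc_log 4 (4 * n); pose j := trunc_log 2 m.
have m0 : (0 < m)%N by rewrite trunc_log_gt0 /=; lia.
have /andP[le_j lt_j] := @trunc_log_bounds 2 m isT m0.
have /andP[le_m lt_m] : (4 ^ m <= 4 * n < 4 ^ m.+1)%N.
  by apply: trunc_log_bounds => //; lia.
exists j; first by apply: leq_trans le_m; rewrite leq_exp2l.
have [h1 h2] := ln2_bounds.
have : ln n%:R <= ln (4 ^ (2 * 2 ^ j))%:R :> R.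
  apply: ln_le_nat => //; apply: leq_trans (_ : 4 * n <= _)%N; first by lia.
  apply: leq_trans (ltnW lt_m) _; rewrite leq_exp2l // -expnS.
  exact: lt_j.
have ln4 : ln 4%:R = 2 * ln 2 :> R.
  by rewrite (_ : 4 = 2 ^ 2)%N // natrX lnXn // mulr_natl.
have -> : ln (4 ^ (2 * 2 ^ j))%:R = (2 * 2 ^ j)%:R * (2 * ln 2) :> R.
  by rewrite natrX lnXn // ln4 -[LHS]mulr_natl.
rewrite natrM => h; apply: le_trans h _.
set u := (2 ^ j)%:R.
have u0 : 0 <= u :> R by [].
nra.
Qed.

End Logarithms.

Local Open Scope ring_scope.

Theorem corollary1p2 (R : realType) (Gamma : groupType) (S : set Gamma)
    (S_finite : finite_set S) (S_generates : generated_subgroup S = [set: Gamma])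
    (Gamma_infinite : infinite_set [set: Gamma])
    (Gamma_nilpotent : nilpotent_group Gamma) :
  growth_equiv (fun n : nat => (residual_growth S n)%:R)
      (fun n : nat => (ln n%:R : R) ^+ hirsch_length [set: Gamma])
  <-> hirsch_length (group_center (quotient_group (torsion Gamma))) = 1%N.
Proof.
have [h pG] := nilpotent_polycyclic S_finite S_generates Gamma_nilpotent.
have [r pZ] := polycyclic_sub (torsion_quotient_polycyclic Gamma_nilpotent pG)
  (@subgroup_center (quotient_group (torsion Gamma))).
rewrite (hirsch_lengthP pG) (hirsch_lengthP pZ).
have finT := torsion_finite Gamma_nilpotent pG.
split=> [[_ [K K0 hK]]|r1].
  case: r pZ => [|[//|r]] pZ.
    by have := center_hirsch_neq0 Gamma_nilpotent pG Gamma_infinite pZ.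
  have [h' eh sep] := separated_large_center Gamma_nilpotent pG pZ; subst h.
  have [C hC] := residual_depth_log S_finite S_generates finT sep.
  (* At n = 2^m the bounds ln 2 >= 1/2 and log(K 2^m) + 1 <= 2 m turn the comparison into m^(h'+1)
     <= B m^h', which fails for m > B. The summand K + 1 of [m] serves the second bound. *)
  pose B := (2 ^ h'.+1 * K * C * 2 ^ h')%N.
  pose m := (B + K + 1)%N.
  have [ln2 _] := @ln2_bounds R.
  have /hK : (0 < 2 ^ m)%N by rewrite expn_gt0.
  rewrite natrX lnXn // => h1.
  have le_log : (trunc_log 2 (K * 2 ^ m).+1 <= K + m)%N.
    rewrite -(trunc_expnK (K + m)%N (ltnSn 1)); apply: leq_trunc_log.
    rewrite expnD; apply: (@leq_trans (K.+1 * 2 ^ m)).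
      by rewrite mulSn -addn1 addnC leq_add2r expn_gt0.
    by rewrite leq_mul2r ltn_expl ?orbT.
  have le_F : (residual_growth S (K * 2 ^ m) <= C * (2 * m) ^ h')%N.
    apply: leq_trans (residual_growth_le (K * 2 ^ m)%N hC) _.
    rewrite leq_mul2l; apply/orP; right.
    case: (h') => // h''; rewrite leq_exp2r //.
    apply: leq_trans (_ : (K + m).+1 <= _)%N => //.
    by rewrite /m; lia.
  have : (m ^ h'.+1 <= B * m ^ h')%N.
    rewrite -(ler_nat R).
    apply: (@le_trans _ _ (2 ^+ h'.+1 * (ln 2 *+ m) ^+ h'.+1)).
      rewrite natrX -exprMn; apply: lerXn2r; rewrite ?nnegrE //.
        by rewrite mulr_ge0 // mulrn_wge0 //; lra.
      rewrite -mulr_natr; have : 0 <= m%:R :> R by [].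
      nra.
    apply: (@le_trans _ _ (2 ^+ h'.+1 * (K%:R * (residual_growth S (K * 2 ^ m))%:R))).
      by apply: ler_wpM2l => //; exact: exprn_ge0.
    rewrite -natrX -!natrM ler_nat /B -!mulnA leq_mul2l; apply/orP; right.
    by rewrite leq_mul2l -expnMn le_F orbT.
  rewrite expnS leq_mul2r expn_eq0 => /orP[|]; first by rewrite /m; lia.
  by rewrite /m; lia.
subst r; split.
  have [C hC] := residual_depth_log S_finite S_generates finT
    (fun s => log_separated_setT s Gamma_nilpotent pG).
  (* One constant serves inside and outside: the 3 and the 4 are those of [trunc_log_le_ln]. *)
  exists (C * 3 ^ h + 4)%N => [|n n0]; first by lia.
  apply: (@le_trans _ _ (C * (trunc_log 2 n.+1).+1 ^ h)%:R).
    by rewrite ler_nat; exact: residual_growth_le.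
  apply: (@le_trans _ _ ((C * 3 ^ h)%:R * ln (4 * n)%:R ^+ h)).
    rewrite natrM natrX (natrM _ C) natrX -mulrA -exprMn; apply: ler_wpM2l => //.
    apply: lerXn2r; rewrite ?nnegrE // ?mulr_ge0 ?ln_ge0_nat //.
    exact: trunc_log_le_ln.
  apply: ler_pM => //.
  - by rewrite exprn_ge0 // ln_ge0_nat.
  - by rewrite ler_nat leq_addr.
  apply: lerXn2r; rewrite ?nnegrE ?ln_ge0_nat //.
  by apply: ln_le_nat; nia.
have [D [K hK]] :=
  residual_growth_lower_bound Gamma_nilpotent pG S_finite S_generates pZ.
(* The first term absorbs ln n <= 4 2^j raised to the power [h], the second K 4^(2^j) <= 4 K n; the
   last keeps the constant positive. *)
exists (4 ^ h * D + 4 * K + 1)%N => [|n n0]; first by lia.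
set E := (_ + 1)%N.
have [j le_j ln_j] := @ln_le_double_power R n n0.
have le_n : (K * 4 ^ (2 ^ j) <= E * n)%N.
  by apply: leq_trans (leq_mul (leqnn K) le_j) _; rewrite /E; nia.
apply: (@le_trans _ _ (4 ^ h * ((2 ^ j) ^ h))%:R).
  rewrite natrM !natrX -exprMn -natrX; apply: lerXn2r => //.
    by rewrite nnegrE ln_ge0_nat.
  by rewrite nnegrE mulr_ge0.
rewrite -natrM ler_nat; apply: leq_trans (leq_mul (leqnn _) (hK j _ le_n)) _.
by rewrite mulnA leq_mul2r /E -addnA leq_addr orbT.
Qed.
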